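(* Let $k=2m-1>1$ and $\mathfrak{g}_k=\mathfrak{p}^A\frac{k|2}{k+2}$ (a Frobenius type-A seaweed). If $m=2$ (i.e. $k=3$), the spectrum of $\mathfrak{g}_k$ is $\{-2,-1^3,0^5,1^5,2^3,3\}$ and its extended spectrum is $\{-3,-2^3,-1^5,0^6,1^5,2^3,3\}$. If $m>2$, the spectrum of $\mathfrak{g}_k$ is $$\{-m,(-m+1)^3,0^{2k-1},1^{2k-1},m^3,m+1\}\cup\bigcup_{i=2}^{m-1}\{(-m+i)^{4i-2},(m-i+1)^{4i-2}\},$$ and its extended spectrum is $$\{-m-1,-m^3,-1^{2k-1},0^{2k},1^{2k-1},m^3,m+1\}\cup\bigcup_{i=1}^{m-2}\{(-m+i)^{4i+2},(m-i)^{4i+2}\}.$$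
   Context: Type-A seaweeds: for compositions $\underline a=(a_1,\dots,a_m)$ and $\underline b=(b_1,\dots,b_t)$ of $n$, let $e_1,\dots,e_n$ be a basis of $V=\mathbb{C}^n$, $V_i=\mathrm{span}\{e_1,\dots,e_{a_1+\dots+a_i}\}$ and $W_j=\mathrm{span}\{e_{b_1+\dots+b_j+1},\dots,e_n\}$. The type-A seaweed $\mathfrak{p}^A\frac{a_1|\cdots|a_m}{b_1|\cdots|b_t}$ is the subalgebra of $\mathfrak{sl}(n)$ of matrices preserving both flags $0\subset V_1\subset\dots\subset V_m=V$ and $V=W_0\supset W_1\supset\dots\supset W_t=0$. A Lie algebra $\mathfrak{g}$ is Frobenius if there is $F\in\mathfrak{g}^*$ with $(x,y)\mapsto F([x,y])$ nondegenerate; then there is a unique $\widehat F\in\mathfrak{g}$ with $F([\widehat F,x])=F(x)$ for all $x$, and the spectrum of $\mathfrak{g}$ is the multiset of eigenvalues of $\mathrm{ad}\,\widehat F$ on $\mathfrak{g}$ (independent of the choice of Frobenius $F$). Meander: $M(\mathfrak{g})$ has vertices $v_1,\dots,v_n$ in a row; the vertices are grouped into consecutive blocks of sizes $a_1,\dots,a_m$, and within each block the first and last vertex, the second and second-to-last, etc., are joined by top edges (when distinct); similarly blocks of sizes $b_1,\dots,b_t$ give bottom edges. Top edges are oriented right to left and bottom edges left to right. For a Frobenius type-A seaweed $M(\mathfrak{g})$ is a single path, so for each $i,j$ there is a unique path $P_{i,j}$ from $v_i$ to $v_j$; its weight $w(P_{i,j})$ is the number of edges traversed along their orientation minus the number traversed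 against it. The extended spectrum is the multiset $\{w(P_{i,j}):1\le i,j\le n\}$ with a single copy of $0$ removed. Notation: $\{x^k\}$ denotes $x$ with multiplicity $k$, and $\cup$ denotes multiset union (multiplicities add). *)

(* Defs.v *)
From HB Require Import structures.
From mathcomp Require Import all_boot all_order all_algebra all_field.
From mathcomp Require Import finmap multiset.
From mathcomp Require Import reals.
From mathcomp Require Import complex.

Set Implicit Arguments.
Unset Strict Implicit.
Unset Printing Implicit Defensive.

Import GRing.Theory.
Local Open Scope ring_scope.

Arguments msetn {K} n%_nat_scope a.

HB.mixin Record Vector_isLie (K : fieldType) L of Vector K L := {
  lie : L -> L -> L;
  lie_linearl : forall y, linear (lie^~ y);
  lie_linearr : forall x, linear (lie x);
  liexx : forall x, lie x x = 0;
  lie_jacobi : forall x y z,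
    lie x (lie y z) + lie y (lie z x) + lie z (lie x y) = 0
}.

#[short(type="lieAlgType")]
HB.structure Definition LieAlg (K : fieldType) :=
  { L of Vector_isLie K L & Vector K L }.

HB.instance Definition _ (K : fieldType) (L : lieAlgType K) (x : L) :=
  GRing.isLinear.Build K L L *:%R (lie x) (lie_linearr x).

Section Frobenius.
Variables (K : fieldType) (L : lieAlgType K).

Definition ad (x : L) : 'End(L) := linfun (lie x).

(* The form (x, y) |-> F [x, y] is alternating, so it is enough to ask that its
   left radical be trivial. *)
Definition frobenius_form (F : 'Hom(L, K^o)) : Prop :=
  forall x, (forall y, F (lie x y) = 0) -> x = 0.

Definition frobenius : Prop := exists F, frobenius_form F.

Definition principal (F : 'Hom(L, K^o)) (h : L) : Prop :=
  forall x, F (lie h x) = F x.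

End Frobenius.

Arguments frobenius {K} L.

(* The roots of the characteristic polynomial, hence the eigenvalues with their
   algebraic multiplicities. *)
Definition eigenvalues (K : closedFieldType) (L : vectType K) (f : 'End(L)) :
    {mset K}%mset :=
  let b := vbasis {:L} in
  seq_mset (sval (closed_field_poly_normal (char_poly (passmx.mxof b b f)))).

(* The principal element of a Frobenius form is unique by nondegeneracy, and
   the multiset S has to serve for all Frobenius forms. *)
Definition has_spectrum (K : closedFieldType) (L : lieAlgType K)
    (S : {mset K}%mset) : Prop :=
  frobenius L /\
  forall F : 'Hom(L, K^o), frobenius_form F ->
    exists2 h : L, principal F h & eigenvalues (ad h) = S.

(* Below, a and b stand for compositions of n: lists of positive integers with
   sum n. *)
Section Seaweed.
Variables (K : fieldType) (n : nat).
Implicit Types (a b : seq nat) (x y : 'M[K]_n).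

Definition basis_vec (i : 'I_n) : 'cV[K]_n := delta_mx i 0.

(* Positions are counted from 0: e_1, ..., e_n are basis_vec 0, ...,
   basis_vec (n - 1). *)
Definition flagV a (i : nat) : {vspace 'cV[K]_n} :=
  <<[seq basis_vec k | k : 'I_n <- enum 'I_n & (k < sumn (take i a))%N]>>%VS.

Definition flagW b (j : nat) : {vspace 'cV[K]_n} :=
  <<[seq basis_vec k | k : 'I_n <- enum 'I_n & (sumn (take j b) <= k)%N]>>%VS.

Definition preserves x (U : {vspace 'cV[K]_n}) : Prop :=
  forall v, v \in U -> x *m v \in U.

Definition stab (U : {vspace 'cV[K]_n}) : {vspace 'M[K]_n} :=
  (\bigcap_(v <- vbasis U) (linfun (fun x : 'M[K]_n => x *m v) @^-1: U))%VS.

Definition sl_vspace : {vspace 'M[K]_n} :=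
  lker (linfun (fun x : 'M[K]_n => \tr x : K^o)).

Definition seaweed a b : {vspace 'M[K]_n} :=
  (sl_vspace
   :&: \bigcap_(i < (size a).+1) stab (flagV a i)
   :&: \bigcap_(j < (size b).+1) stab (flagW b j))%VS.

Lemma mem_stab U x : reflect (preserves x U) (x \in stab U).
Proof.
have mulE (v : 'cV[K]_n) y : linfun (fun x : 'M[K]_n => x *m v) y = y *m v.
  pose f : {linear 'M[K]_n -> 'cV[K]_n} := mulmxr v.
  by rewrite -[LHS]/(linfun f y) lfunE.
have stabE (s : seq 'cV[K]_n) :
  (x \in (\bigcap_(v <- s)
            (linfun (fun x : 'M[K]_n => x *m v) @^-1: U))%VS) =
  all (fun v => x *m v \in U) s.
  elim: s => [|v s IHs]; first by rewrite big_nil memvf.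
  by rewrite big_cons memv_cap IHs -memv_preim mulE.
rewrite /stab stabE; apply: (iffP allP) => [Ux v Uv|Ux v /vbasis_mem /Ux //].
rewrite (coord_vbasis Uv) mulmx_sumr rpred_sum // => i _.
by rewrite -scalemxAr rpredZ // Ux // mem_nth // size_tuple.
Qed.

Lemma mem_seaweed a b x :
  x \in seaweed a b <->
  [/\ \tr x = 0,
      forall i : nat, (i <= size a)%N -> preserves x (flagV a i) &
      forall j : nat, (j <= size b)%N -> preserves x (flagW b j)].
Proof.
have trE : (x \in sl_vspace) = (\tr x == 0).
  pose f : {linear 'M[K]_n -> K^o} := @mxtrace K n.
  by rewrite memv_ker -[linfun _ x]/(linfun f x) lfunE.
have capE m (U : nat -> {vspace 'M[K]_n}) :
  reflect (forall i, (i < m)%N -> x \in U i) (x \in (\bigcap_(i < m) U i)%VS).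
  rewrite memvE; apply: (iffP subv_bigcapP) => [Ux i im | Ux i _].
    by rewrite memvE (Ux (Ordinal im)).
  by rewrite -memvE Ux.
have VE := capE (size a).+1 (fun i => stab (flagV a i)).
have WE := capE (size b).+1 (fun j => stab (flagW b j)).
rewrite /seaweed !memv_cap trE; split.
  case/andP=> /andP[/eqP tr0 /VE Vx] /WE Wx; split=> // i ile.
    by apply/mem_stab; apply: Vx.
  by apply/mem_stab; apply: Wx.
case=> tr0 Vx Wx; rewrite tr0 eqxx /=.
by apply/andP; split; [apply/VE | apply/WE] => i ile; apply/mem_stab; auto.
Qed.

Definition commutator x y : 'M[K]_n := x *m y - y *m x.

Lemma commutator_seaweed a b x y :
  x \in seaweed a b -> y \in seaweed a b -> commutator x y \in seaweed a b.
Proof.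
have pres U : preserves x U -> preserves y U -> preserves (commutator x y) U.
  by move=> xU yU v Uv; rewrite mulmxBl -!mulmxA rpredB ?xU ?yU // ?xU ?yU.
move=> /mem_seaweed[_ xV xW] /mem_seaweed[_ yV yW]; apply/mem_seaweed; split.
- by rewrite raddfB /= mxtrace_mulC subrr.
- by move=> i ile; apply: pres; [apply: xV | apply: yV].
- by move=> j jle; apply: pres; [apply: xW | apply: yW].
Qed.

Definition seaweedLie a b : Type := subvs_of (seaweed a b).

HB.instance Definition _ a b := Vector.on (seaweedLie a b).

Section Bracket.
Variables (a b : seq nat).
Local Notation g := (seaweedLie a b).

Definition seaweed_lie (x y : g) : g :=
  Subvs (commutator_seaweed (subvsP x) (subvsP y)).

Lemma seaweed_lie_linearl (y : g) : linear (seaweed_lie^~ y).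
Proof.
move=> c u v; apply: val_inj; rewrite /= /commutator /=.
by rewrite mulmxDl mulmxDr -scalemxAl -scalemxAr scalerBr opprD addrACA.
Qed.

Lemma seaweed_lie_linearr (x : g) : linear (seaweed_lie x).
Proof.
move=> c u v; apply: val_inj; rewrite /= /commutator /=.
by rewrite mulmxDl mulmxDr -scalemxAl -scalemxAr scalerBr opprD addrACA.
Qed.

Lemma seaweed_liexx (x : g) : seaweed_lie x x = 0.
Proof. by apply: val_inj; rewrite /= /commutator subrr. Qed.

Lemma seaweed_jacobi (x y z : g) :
  seaweed_lie x (seaweed_lie y z) + seaweed_lie y (seaweed_lie z x)
  + seaweed_lie z (seaweed_lie x y) = 0.
Proof.
apply: val_inj; rewrite /= /commutator /=.
rewrite !(mulmxBl, mulmxBr) !mulmxA !opprB !addrA.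
rewrite !subrK.
have cancel8 (p q r t : 'M[K]_n) : p - q + r - t + q - r + t - p = 0.
  rewrite (addrAC _ (- t) q) (addrAC _ r q) subrK (addrAC _ (- t) (- r)).
  by rewrite addrK subrK subrr.
exact: cancel8.
Qed.

HB.instance Definition _ := Vector_isLie.Build K (seaweedLie a b)
  seaweed_lie_linearl seaweed_lie_linearr seaweed_liexx seaweed_jacobi.
End Bracket.
End Seaweed.

Section Meander.
Variable n : nat.
Implicit Types (a b : seq nat) (u v : 'I_n).

(* u and v lie in the same block [s, s + c) of a, at mirror positions. *)
Definition block_edge a u v : bool :=
  (u != v) &&
  [exists j : 'I_(size a),
     let s := sumn (take j a) in let c := nth 0%N a j in
     [&& s <= u < s + c, s <= v < s + c & (u - s) + (v - s) == c.-1]%N].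

(* Top edges (from a) point leftwards, bottom edges (from b) rightwards. *)
Definition arc a b u v : bool :=
  (block_edge a u v && (v < u)%N) || (block_edge b u v && (u < v)%N).

Definition adjacent a b u v : bool := arc a b u v || arc a b v u.

(* p lists the vertices visited after u.  An edge is determined by its end
   points unless a top edge and a bottom edge are parallel; this does not occur
   when the meander is a single path. *)
Definition meander_path a b u p v : bool :=
  [&& path (adjacent a b) u p, uniq (u :: p) & last u p == v].

Definition step_weight a b u v : int := (arc a b u v)%:Z - (arc a b v u)%:Z.

Definition weight a b u (p : seq 'I_n) : int :=
  \sum_(e <- zip (u :: p) p) step_weight a b e.1 e.2.

(* P i j is required to be the only path from i to j. *)
Definition has_extended_spectrum a b (E : {mset int}%mset) : Prop :=
  exists2 P : 'I_n -> 'I_n -> seq 'I_n,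
    forall i j p, meander_path a b i p j <-> p = P i j &
    E = (seq_mset [seq weight a b i (P i j) | i <- enum 'I_n, j <- enum 'I_n]
         `\ 0)%mset.

End Meander.

(* Main.v *)
Require Import Defs.
From HB Require Import structures.
From mathcomp Require Import all_boot all_order all_algebra all_field.
From mathcomp Require Import finmap multiset.
From mathcomp Require Import reals.
From mathcomp Require Import complex.
From mathcomp Require Import ring zify.

(** The meander of k|2 / k+2 is a single path; let ht v be the weight of the
    path from one fixed vertex to v, up to a constant.  The form
    F = sum of the coordinates x_(u,v) over the arcs u -> v is Frobenius, with
    diagonal principal element c - ht, so that E_(u,v) is an eigenvector of
    eigenvalue ht v - ht u, the weight of the path from u to v.  Written along
    the path, the heights are 0, 1, ..., m+1, m, ..., 2, and both multisets
    count differences between the intervals [0, m+1] and [2, m].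

    That every Frobenius form yields the same spectrum is obtained by
    differentiating along the line F_t = F_0 + t (F_1 - F_0).  Where F_t is
    Frobenius, F_1 - F_0 = F_t o ad y for some y, and then the principal element
    h_t has derivative [h_t, y].  Hence the derivative of ad h_t is a commutator
    with ad h_t, and its characteristic polynomial is constant; being a rational
    function of t it takes the same value at 0 and 1. *)

Set Implicit Arguments.
Unset Strict Implicit.
Unset Printing Implicit Defensive.
Import Order.TTheory GRing.Theory Num.Theory.
Local Open Scope ring_scope.

(** * Derivatives of determinants *)

Section DerivDet.
Variable R : comNzRingType.

Lemma deriv_prod (I : finType) (F : I -> {poly R}) :
  (\prod_i F i)^`() = \sum_i (F i)^`() * \prod_(j | j != i) F j.
Proof.
(* The induction runs over duplicate-free lists, where the condition j != i removes exactly one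
   factor. *)
have gen (s : seq I) : uniq s ->
    (\prod_(i <- s) F i)^`() =
    \sum_(i <- s) (F i)^`() * \prod_(j <- s | j != i) F j.
  elim: s => [|i s IHs]; first by rewrite !big_nil derivC.
  rewrite cons_uniq => /andP[i_s s_uniq]; rewrite !big_cons derivM IHs // eqxx /=.
  congr (_ * _ + _).
    rewrite [RHS]big_seq_cond [LHS]big_seq; apply: eq_bigl => j.
    by have [->|] := eqVneq j i; rewrite ?(negPf i_s) ?andbT.
  rewrite big_distrr /= big_seq [RHS]big_seq; apply: eq_bigr => j js.
  rewrite big_cons ifT; last by apply: contraNneq i_s => ->.
  by rewrite mulrCA.
by rewrite gen // /index_enum -enumT enum_uniq.
Qed.

(** Jacobi's formula. By the Leibniz expansion the derivative is the sum over i of the determinants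
    [B i] in which only row i is differentiated; expanding each along that row produces the
    cofactors. *)
Lemma deriv_det d (A : 'M[{poly R}]_d) :
  (\det A)^`() = \tr (\adj A *m map_mx deriv A).
Proof.
pose B i := \matrix_(k, l) if k == i then (A k l)^`() else A k l.
transitivity (\sum_i \det (B i)).
  rewrite /determinant linear_sum /= exchange_big /=; apply: eq_bigr => s _.
  have sgnD (b : bool) (p : {poly R}) : ((-1) ^+ b * p)^`() = (-1) ^+ b * p^`().
    by case: b; rewrite ?expr1 ?expr0 ?mul1r // !mulN1r derivN.
  rewrite sgnD deriv_prod big_distrr /=; apply: eq_bigr => i _.
  congr (_ * _).
  rewrite [RHS](bigD1 i) //= mxE eqxx; congr (_ * _).
  by apply: eq_bigr => j /negPf ji; rewrite mxE ji.
rewrite mxtrace_mulC; apply: eq_bigr => i _.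
rewrite (expand_det_row _ i) mxE; apply: eq_bigr => j _.
rewrite !mxE eqxx; congr (_ * (_ * \det _)).
by apply/matrixP=> k l; rewrite !mxE eq_sym (negPf (neq_lift _ _)).
Qed.

End DerivDet.

(** * Polynomial identities in characteristic zero *)

Section LogDeriv.
Variables (K : fieldType).
Hypothesis char0 : forall n, n.+1%:R != 0 :> K.

(* A non-trivial solution vanishing at 0 to order s > 0 would make the left side
   vanish to order s - 1 and the right side to order s. *)
Lemma log_deriv_eq0 (d : nat) (q p : {poly K}) :
  q * p^`() = p * q^`() *+ d -> q.[0] != 0 -> p.[0] = 0 -> p = 0.
Proof.
move=> ode q0 p0; apply/eqP/contraT => p_neq0.
have [s [r]] := multiplicity_XsubC p 0; rewrite p_neq0 /= => r0.
case: s => [|s] def_p.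
  by move: r0; rewrite -[r]mulr1 -(expr0 ('X - 0%:P)) -def_p /root p0 eqxx.
have X0 : 'X - 0%:P = 'X :> {poly K} by rewrite polyC0 subr0.
have := ode; rewrite def_p X0 derivM derivXn.
have -> : q * (r^`() * 'X ^+ s.+1 + r * ('X ^+ s *+ s.+1)) =
  'X ^+ s * (q * (r^`() * 'X + r *+ s.+1)).
  by rewrite exprS mulrnAr -mulrnAl [r^`() * _]mulrA -mulrDl [LHS]mulrA [RHS]mulrC.
have -> : r * 'X ^+ s.+1 * q^`() *+ d = 'X ^+ s * ('X * (r * q^`()) *+ d).
  rewrite mulrnAr exprS; congr (_ *+ d).
  by rewrite [r * _]mulrA mulrAC mulrC -[r * 'X * _]mulrA [r * _]mulrCA.
move/(mulfI (monic_neq0 (monicXn _ _)))/(congr1 (horner^~ 0)).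
rewrite /= hornerM hornerD hornerM !hornerMn hornerM hornerX mulr0 mul0r mul0rn add0r.
move/eqP; rewrite mulf_eq0 (negPf q0) /= -mulr_natr mulf_eq0 (negPf (char0 _)) orbF.
by rewrite -[_ == 0]/(root r 0) (negPf r0).
Qed.

(** The product (p - q) r vanishes at every natural number, and in characteristic zero these are
    more distinct roots than its size allows. *)
Lemma poly_eq_nonroots (p q r : {poly K}) : r != 0 ->
  (forall t, r.[t] != 0 -> p.[t] = q.[t]) -> p = q.
Proof.
move=> r0 pq; apply/eqP; rewrite -subr_eq0; apply/contraT => pq0.
have nz : (p - q) * r != 0 by rewrite mulf_neq0.
have natI : injective (fun n : nat => n%:R : K).
  have wlog_lt i j : (i < j)%N -> i%:R <> j%:R :> K.
    move=> ij /eqP; rewrite -(subnKC (ltnW ij)) natrD -subr_eq0 opprD addrA subrr.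
    by rewrite sub0r oppr_eq0 -(subnSK ij) (negPf (char0 _)).
  move=> i j /= eqij; case: (ltngtP i j) => // /wlog_lt //.
  by move/(_ (esym eqij)).
have := max_poly_roots nz (rs := [seq n%:R | n <- iota 0 (size ((p - q) * r))]).
rewrite map_inj_uniq // iota_uniq size_map size_iota ltnn => H.
suff: false by []; apply: H => //.
apply/allP => _ /mapP[n _ ->]; rewrite rootM.
have [//|rn] := boolP (root r n%:R); first by rewrite orbT.
by rewrite orbF /root !hornerE pq ?subrr.
Qed.

End LogDeriv.

(** * Principal elements of Frobenius forms *)

Section Principal.
Variables (K : fieldType) (d : nat) (T : {linear 'rV[K]_d -> 'M[K]_d}).
Hypothesis char0 : forall n, n.+1%:R != 0 :> K.
(** In coordinates [u *m T v] is the bracket [v, u], so that [T u] is the matrix of ad u acting on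
    rows and the hypothesis is the Jacobi identity. A form is a column f: [T u *m f = 0] says that u
    lies in the radical, [T u *m f = f] that u is principal. *)
Hypothesis T_lie : forall u v, T (u *m T v) = T u *m T v - T v *m T u.

Let evmx (t : K) m n (A : 'M[{poly K}]_(m, n)) : 'M[K]_(m, n) :=
  map_mx (horner_eval t) A.
Let dermx m n (A : 'M[{poly K}]_(m, n)) : 'M[{poly K}]_(m, n) := map_mx deriv A.

Let dermxM m n p (A : 'M[{poly K}]_(m, n)) (B : 'M_(n, p)) :
  dermx (A *m B) = dermx A *m B + A *m dermx B.
Proof.
apply/matrixP=> i j; rewrite !mxE linear_sum -big_split /=.
by apply: eq_bigr => k _; rewrite derivM !mxE.
Qed.

(** The extension of [T] to polynomial coordinates, compatible with evaluation and with
    derivation. *)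
Let Tpoly (u : 'rV[{poly K}]_d) : 'M[{poly K}]_d :=
  \sum_i u 0 i *: map_mx polyC (T (delta_mx 0 i)).

Let ev_Tpoly t u : evmx t (Tpoly u) = T (evmx t u).
Proof.
rewrite [evmx t u]row_sum_delta linear_sum /evmx map_mx_sum /=.
apply: eq_bigr => i _; rewrite linearZ /= mxE; apply/matrixP=> k l.
by rewrite !mxE /horner_eval hornerM hornerC.
Qed.

Let der_Tpoly u : dermx (Tpoly u) = Tpoly (dermx u).
Proof.
apply/matrixP=> k l; rewrite !mxE !summxE linear_sum /=.
by apply: eq_bigr => i _; rewrite !mxE derivM derivC mulr0 addr0.
Qed.

(** The Gram matrix of the alternating form (u, v) |-> f [u, v]. *)
Definition formmx (f : 'cV[K]_d) : 'M[K]_d :=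
  \matrix_(i, j) (T (delta_mx 0 i) *m f) j 0.

Lemma mul_formmx (f : 'cV[K]_d) u : u *m formmx f = (T u *m f)^T.
Proof.
rewrite {2}[u]row_sum_delta linear_sum mulmx_suml; apply/rowP=> j.
rewrite !mxE summxE; apply: eq_bigr => i _.
by rewrite linearZ -scalemxAl !mxE.
Qed.

Lemma formmx_unit f : (forall u, T u *m f = 0 -> u = 0) -> formmx f \in unitmx.
Proof.
move=> f_inj; rewrite -row_free_unit -kermx_eq0; apply/eqP/row_matrixP=> i.
rewrite row0; apply: f_inj; apply: trmx_inj.
by rewrite -mul_formmx -row_mul mulmx_ker row0 trmx0.
Qed.

(* D and N clear the denominators of the principal vectors h = N / D of the
   forms f.  The identity [ode] says that g / D ^+ d has derivative 0. *)
Lemma char_poly_principal (f0 f1 : 'cV[K]_d) (u0 u1 : 'rV[K]_d) :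
    (forall u, T u *m f0 = 0 -> u = 0) -> (forall u, T u *m f1 = 0 -> u = 0) ->
    T u0 *m f0 = f0 -> T u1 *m f1 = f1 ->
  char_poly (T u0) = char_poly (T u1).
Proof.
move=> inj0 inj1 pr0 pr1.
pose f : 'cV[{poly K}]_d := map_mx polyC f0 + 'X *: map_mx polyC (f1 - f0).
have ev_f t : evmx t f = f0 + t *: (f1 - f0).
  by apply/matrixP=> i j; rewrite !mxE /horner_eval !hornerE.
have der_f : dermx f = map_mx polyC (f1 - f0).
  by apply/matrixP=> i j; rewrite !mxE derivD derivM !derivC derivX mulr0 !addr0 add0r mul1r.
pose M : 'M[{poly K}]_d := 
  map_mx polyC (formmx f0) + 'X *: map_mx polyC (formmx (f1 - f0)).
have ev_M t : evmx t M = formmx (evmx t f).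
  apply/matrixP=> i j; rewrite ev_f [RHS]mxE mulmxDr -scalemxAr [RHS]mxE [X in _ + X]mxE.
  by rewrite !mxE /horner_eval !hornerE.
have der_M t u : u *m evmx t (dermx M) = (T u *m (f1 - f0))^T.
  rewrite -mul_formmx; congr (_ *m _); apply/matrixP=> i j.
  by rewrite !mxE derivD derivM !derivC derivX mulr0 addr0 add0r mul1r /horner_eval hornerC.
pose D := \det M.
(* Cramer's rule for the equation h M = f^T, which characterizes the principal vector. *)
pose N := f^T *m \adj M.
have NM : N *m M = D *: f^T by rewrite -mulmxA mul_adj_mx mul_mx_scalar.
have evM t m n p (A : 'M_(m, n)) (B : 'M_(n, p)) :
  evmx t (A *m B) = evmx t A *m evmx t B by rewrite /evmx map_mxM.
have ev_NM t : T (evmx t N) *m evmx t f = D.[t] *: evmx t f.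
  apply: trmx_inj; rewrite -mul_formmx -ev_M -evM NM linearZ /=.
  by apply/matrixP=> i j; rewrite !mxE /horner_eval hornerM.
have D_ev t : D.[t] = \det (evmx t M) by rewrite -[LHS]/(horner_eval t _) -det_map_mx.
have D0 : D.[0] != 0.
  by rewrite D_ev ev_M ev_f scale0r addr0 -unitfE -unitmxE formmx_unit.
have D1 : D.[1] != 0.
  by rewrite D_ev ev_M ev_f scale1r subrKC -unitfE -unitmxE formmx_unit.
have D_neq0 : D != 0 by apply: contraNneq D0 => ->; rewrite horner0.
(* Away from the roots of D this is D (x - ad h), so that its determinant [g x] is D ^+ d times the
   characteristic polynomial of ad h at x. *)
pose A x := (x *: D)%:M - Tpoly N.
have ev_A x t : evmx t (A x) = (x * D.[t])%:M - T (evmx t N).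
  rewrite -ev_Tpoly; apply/matrixP=> i j.
  by rewrite !mxE /horner_eval hornerD hornerN hornerMn hornerZ.
pose g x := \det (A x).
have g_ev x t : (g x).[t] = \det (evmx t (A x)).
  by rewrite -[LHS]/(horner_eval t _) -det_map_mx.
have ode x : D * (g x)^`() = g x * D^`() *+ d.
  apply: (poly_eq_nonroots char0 D_neq0) => t Dt.
  have [h hf Nh] : exists2 h, T h *m evmx t f = evmx t f & evmx t N = D.[t] *: h.
    exists (D.[t]^-1 *: evmx t N); last by rewrite scalerA mulfV // scale1r.
    by rewrite linearZ /= -scalemxAl ev_NM scalerA mulVf // scale1r.
  have Mt : evmx t M \in unitmx by rewrite unitmxE unitfE -D_ev.
  (* The direction f1 - f0 of the line is the composite of the form at t with ad y, because its Gram
     matrix is invertible. *)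
  have [y yf] : exists y, T y *m evmx t f = f1 - f0.
    exists ((f1 - f0)^T *m invmx (evmx t M)).
    by apply: trmx_inj; rewrite -mul_formmx -ev_M mulmxKV.
  (* The bracket [h, y], which turns out to be the derivative of h. *)
  pose z := y *m T h.
  have N' : evmx t (dermx N) = D^`().[t] *: h + D.[t] *: z.
    (* Both sides are compared after multiplication by the invertible M; the left one then comes
       from differentiating [NM]. *)
    apply: (can_inj (mulmxK Mt)).
    have := congr1 (fun B => evmx t (dermx B)) NM; rewrite /= dermxM.
    have -> : dermx (D *: f^T) = D^`() *: f^T + D *: (dermx f)^T.
      by apply/matrixP=> i j; rewrite !mxE derivM.
    rewrite der_f.
    have -> : evmx t (dermx N *m M + N *m dermx M) =
      evmx t (dermx N) *m evmx t M + evmx t N *m evmx t (dermx M).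
      by rewrite -!evM /evmx map_mxD.
    rewrite der_M => /(canRL (addrK _)) ->.
    have -> : evmx t (D^`() *: f^T + D *: (map_mx polyC (f1 - f0))^T) =
      D^`().[t] *: (evmx t f)^T + D.[t] *: (f1 - f0)^T.
      by apply/matrixP=> i j; rewrite !mxE /horner_eval !hornerE.
    rewrite mulmxDl -!scalemxAl ev_M !mul_formmx hf T_lie Nh linearZ /=.
    rewrite mulmxBl -!mulmxA hf yf -scalemxAl linearZ /=.
    by rewrite [(_ - T h *m _)^T]linearB /= scalerBr addrA.
  (* Up to the factor coming from D, the derivative of A is its commutator with T y. *)
  have A' : D.[t] *: evmx t (dermx (A x)) = D^`().[t] *: evmx t (A x)
      + D.[t] *: (T y *m evmx t (A x) - evmx t (A x) *m T y).
    have -> : evmx t (dermx (A x)) = (x * D^`().[t])%:M - T (evmx t (dermx N)).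
      rewrite -ev_Tpoly -der_Tpoly; apply/matrixP=> i j.
      by rewrite !mxE derivB derivMn derivZ /horner_eval hornerD hornerN hornerMn hornerZ.
    have TZ a u : T (a *: u) = a *: T u by rewrite linearZ.
    have TD u v : T (u + v) = T u + T v by rewrite linearD.
    rewrite N' ev_A Nh TD !TZ T_lie mulmxBl mulmxBr -!scalemxAl -!scalemxAr scalar_mxC.
    by apply/matrixP=> i j; rewrite !mxE; ring.
  (* The adjugate commutes with its matrix, so the commutator contributes nothing to Jacobi's
     formula. *)
  have trA : \tr (\adj (evmx t (A x)) *m
      (T y *m evmx t (A x) - evmx t (A x) *m T y)) = 0.
    rewrite mulmxBr linearB /= [X in _ - \tr X]mulmxA mul_adj_mx mulmxA.
    by rewrite mxtrace_mulC mulmxA mul_mx_adj subrr.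
  rewrite hornerM deriv_det hornerMn hornerM.
  have -> : (\tr (\adj (A x) *m map_mx deriv (A x))).[t] =
      \tr (\adj (evmx t (A x)) *m evmx t (dermx (A x))).
    by rewrite -[LHS]/(horner_eval t _) -trace_map_mx map_mxM map_mx_adj.
  rewrite -mxtraceZ scalemxAr A' mulmxDr linearD /= -!scalemxAr !linearZ /= trA.
  rewrite mulr0 addr0 mul_adj_mx mxtrace_scalar g_ev.
  by rewrite mulrnAr mulrC.
have det_eq x : \det (x%:M - T u0) = \det (x%:M - T u1).
  (* Both [g x] and [D ^+ d] solve the equation [ode]; this constant makes g x - c D ^+ d vanish at
     0, hence identically. *)
  pose c := (g x).[0] / D.[0] ^+ d.
  have: g x - c *: D ^+ d = 0.
    apply: (log_deriv_eq0 char0 (d := d) (q := D)) => //.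
      rewrite derivB derivZ mulrBr ode mulrBl mulrnBl -scalerAr -scalerAl.
      have -> : D * (D ^+ d)^`() = D ^+ d * D^`() *+ d.
        case: (d) => [|e]; first by rewrite expr0 derivC mulr0 mulr0n.
        by rewrite deriv_exp /= exprS mulrnAr [D^`() * _]mulrC mulrA.
      by rewrite scalerMnr.
    by rewrite hornerD hornerN hornerZ horner_exp mulfVK ?subrr // expf_neq0.
  move/(congr1 (horner^~ 1)).
  rewrite horner0 hornerD hornerN hornerZ horner_exp => /eqP; rewrite subr_eq0 => /eqP.
  (* At a parameter with nondegenerate form the principal vector is unique, so N = D u there; this
     is applied at 0 and 1. *)
  have gE t u ft : T u *m ft = ft -> evmx t f = ft -> D.[t] != 0 ->
      (g x).[t] = D.[t] ^+ d * \det (x%:M - T u).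
    move=> hu hft Dt; rewrite g_ev ev_A -detZ; congr (\det _).
    have -> : evmx t N = D.[t] *: u.
      have Mt : evmx t M \in unitmx by rewrite unitmxE unitfE -D_ev.
      apply: (can_inj (mulmxK Mt)); apply: trmx_inj.
      by rewrite -scalemxAl ev_M !mul_formmx linearZ /= !trmxK ev_NM hft hu.
    by rewrite linearZ scalerBr scale_scalar_mx mulrC.
  have -> : c = \det (x%:M - T u0).
    by rewrite /c (gE 0 u0 f0) ?ev_f ?scale0r ?addr0 // mulrAC mulfV ?mul1r ?expf_neq0.
  rewrite (gE 1 u1 f1) ?ev_f ?scale1r ?subrKC // mulrC.
  by move/(mulIf (expf_neq0 d D1)).
apply: (poly_eq_nonroots char0 (oner_neq0 _)) => x _.
have evc (B : 'M[K]_d) : (char_poly B).[x] = \det (x%:M - B).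
  rewrite -[LHS]/(horner_eval x _) -det_map_mx; congr (\det _).
  by apply/matrixP=> i j; rewrite !mxE rmorphB rmorphMn /= /horner_eval hornerX hornerC.
by rewrite !evc.
Qed.
End Principal.

(** * Eigenvalues of ad in coordinates *)

Section LieSpectrum.
Import passmx.
Variables (K : closedFieldType) (L : lieAlgType K).
Hypothesis char0 : forall n, n.+1%:R != 0 :> K.

Lemma lieC (x y : L) : lie x y = - lie y x.
Proof.
have lieDl u v w : lie (u + v) w = lie u w + lie v w :> L.
  by have := lie_linearl w 1 u v; rewrite /= !scale1r.
have := liexx (x + y); rewrite lieDl !linearD /= !liexx add0r addr0.
by move/eqP; rewrite addr_eq0 => /eqP.
Qed.

(** In the basis b, the matrices of ad and the columns of values of the forms meet the assumptions
    of [char_poly_principal]. *)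
Lemma eigenvalues_principal (F0 F1 : 'Hom(L, K^o)) (h0 h1 : L) :
    frobenius_form F0 -> frobenius_form F1 ->
    principal F0 h0 -> principal F1 h1 ->
  eigenvalues (ad h0) = eigenvalues (ad h1).
Proof.
move=> frob0 frob1 pr0 pr1; rewrite /eigenvalues; set b := vbasis _.
have bB : basis_of {:L} b by exact: vbasisP.
pose Tf (u : 'rV[K]_(\dim {:L})) := mxof b b (ad (vecof b u)).
have Tlin : linear Tf.
  move=> a u v; rewrite /Tf.
  have -> : ad (vecof b (a *: u + v)) = a *: ad (vecof b u) + ad (vecof b v).
    by apply/lfunP=> w; do !rewrite !lfunE /=; rewrite linearP; exact: lie_linearl.
  by rewrite linearP.
pose TfL := GRing.isLinear.Build K _ _ _ Tf Tlin.
pose T : {linear 'rV[K]_(\dim {:L}) -> 'M[K]_(\dim {:L})} := HB.pack Tf TfL.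
have TE u v : u *m T v = rVof b (lie (vecof b v) (vecof b u)).
  by rewrite mul_mxof lfunE.
pose fv (F : 'Hom(L, K^o)) : 'cV[K]_(\dim {:L}) := \col_i F b`_i.
have fvE F u : (u *m fv F) 0 0 = F (vecof b u).
  by rewrite /vecof linear_sum mxE; apply: eq_bigr => i _; rewrite linearZ mxE.
have TF F u v : (v *m (T u *m fv F)) 0 0 = F (lie (vecof b u) (vecof b v)).
  by rewrite mulmxA fvE TE rVofK.
have inj F : frobenius_form F -> forall u, T u *m fv F = 0 -> u = 0.
  move=> frobF u Tu0; apply/eqP; rewrite -(vecof_eq0 bB); apply/eqP/frobF=> y.
  by rewrite -(rVofK bB y) -TF Tu0 mulmx0 mxE.
have pr F h : principal F h -> T (rVof b h) *m fv F = fv F.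
  move=> prF; apply/row_matrixP=> i; apply/rowP=> j; rewrite ord1 !rowE TF fvE.
  by rewrite rVofK // prF.
have Tad h : T (rVof b h) = mxof b b (ad h) by rewrite /= /Tf rVofK.
rewrite -!Tad (@char_poly_principal _ _ T char0 _ (fv F0) (fv F1) _ (rVof b h1)) //.
(* The remaining condition on [T] is the Jacobi identity of L. *)
- move=> u v; rewrite TE /= /Tf rVofK // -!mxof_comp // -linearB /=.
  congr (mxof b b _); apply/lfunP=> w; do !rewrite !lfunE /=.
  have := lie_jacobi (vecof b v) (vecof b u) w.
  rewrite [lie w (lie _ _)]lieC => /eqP; rewrite subr_eq0 => /eqP <-.
  by rewrite [lie w _]lieC linearN.
- exact: inj.
- exact: inj.
- exact: pr.
- exact: pr.
Qed.

(** In the basis X the matrix of ad h is diagonal, and the change of basis to [vbasis] preserves the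
    characteristic polynomial. *)
Lemma eigenvalues_eigenbasis (h : L) (N : nat) (X : N.-tuple L) (s : 'I_N -> K) :
    basis_of {:L} X -> (forall i : 'I_N, lie h X`_i = s i *: X`_i) ->
  eigenvalues (ad h) = seq_mset [seq s i | i <- enum 'I_N].
Proof.
move=> XB; have dimN := size_basis XB; subst N => hX; rewrite /eigenvalues.
set b := vbasis _; have bB : basis_of {:L} b by exact: vbasisP.
have mxX : mxof X X (ad h) = diag_mx (\row_i s i).
  apply/matrixP=> i j; rewrite !mxE vecof_delta lfunE /= hX linearZ /=.
  by rewrite coord_free ?(basis_free XB) // mulr_natr.
pose r0 := [seq s i | i <- enum 'I_(\dim {:L})].
have -> : char_poly (mxof b b (ad h)) = \prod_(i <- r0) ('X - i%:P).
  have -> : \prod_(i <- r0) ('X - i%:P) = char_poly (mxof X X (ad h)).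
    rewrite mxX char_poly_trig ?diag_mx_is_trig // big_map big_enum.
    by apply: eq_bigr => i _; rewrite !mxE eqxx.
  pose P := mxof b X \1%VF; pose Q := mxof X b \1%VF.
  have QP : Q *m P = 1%:M by rewrite -mxof_comp // comp_lfun1l mxof1 // (basis_free XB).
  have PQ : P *m Q = 1%:M by rewrite -mxof_comp // comp_lfun1l mxof1 // (basis_free bB).
  have comm : mxof b b (ad h) *m P = P *m mxof X X (ad h).
    by rewrite -!mxof_comp // comp_lfun1l comp_lfun1r.
  have -> : mxof X X (ad h) = Q *m mxof b b (ad h) *m P by rewrite -mulmxA comm mulmxA QP mul1mx.
  rewrite /char_poly /char_poly_mx !map_mxM /=; set A := map_mx _ _.
  have pQP : map_mx polyC Q *m map_mx polyC P = 1%:M by rewrite -map_mxM QP map_mx1.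
  have -> : 'X%:M - map_mx polyC Q *m A *m map_mx polyC P = 
     map_mx polyC Q *m ('X%:M - A) *m map_mx polyC P.
    by rewrite mulmxBr mulmxBl mul_mx_scalar -scalemxAl pQP scalemx1.
  rewrite !det_mulmx mulrAC -det_mulmx pQP det1 mul1r //.
case: closed_field_poly_normal => r /= Hr; apply/eq_seq_msetP/prod_XsubC_eq.
rewrite Hr (monicP _) ?scale1r // monic_prod_XsubC //.
Qed.
End LieSpectrum.

(** * The meander as a path *)

Section Vertices.
Variable m : nat.
Hypothesis m_gt1 : (1 < m)%N.

(* Vertices are counted from 0.  The path starts at one of the two middle vertices
   m - 1, m and visits first all even vertices, then 2 m - 1, then the other odd
   ones; [position u] is the rank of u on it and [vertex] its inverse. *)
Definition position (u : nat) : nat :=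
  let s := (if u < m then m - 1 - u else u - m)%N in
  (if odd u then 2 * m - s else s)%N.

Definition vertex (t : nat) : nat :=
  (if t <= m then if odd (m + t) then m - 1 - t else m + t
   else if odd (m + t) then 3 * m - t else t - m - 1)%N.

Definition pos_height (t : nat) : nat := (if t <= m + 1 then t else 2 * m + 2 - t)%N.

Definition height (u : nat) : nat := pos_height (position u).

(* The arcs converge to the sink of position m + 1. *)
Definition pos_arc (s t : nat) : bool :=
  ((t == s + 1) && (s <= m) || (s == t + 1) && (m + 2 <= s))%N.

Lemma vertex_lt t : (t <= 2 * m)%N -> (vertex t <= 2 * m)%N.
Proof. by rewrite /vertex; do ![case: ifP] => *; lia. Qed.

Lemma position_lt u : (u <= 2 * m)%N -> (position u <= 2 * m)%N.
Proof. by rewrite /position; do ![case: ifP] => *; lia. Qed.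

Lemma positionK u : (u <= 2 * m)%N -> vertex (position u) = u.
Proof. by rewrite /position /vertex; do ![case: ifP] => *; lia. Qed.

Lemma vertexK t : (t <= 2 * m)%N -> position (vertex t) = t.
Proof. by rewrite /position /vertex; do ![case: ifP] => *; lia. Qed.

(** The top block of size 2 sits in the middle of the path: vertex 2 m has position m, and vertex 2
    m - 1 is the sink, at position m + 1. *)
Lemma vertex_low t : (t <= 2 * m)%N ->
  (2 * m - 1 <= vertex t)%N = (t == m) || (t == m + 1)%N.
Proof. by rewrite /vertex; do ![case: ifP] => *; lia. Qed.

Lemma block_edge2 k (u v : 'I_(k + 2)) :
  block_edge [:: k; 2%N] u v =
  (u != v :> nat) && [|| [&& u < k, v < k & u + v == k.-1]
    | [&& k <= u, k <= v & u + v == 2 * k + 1]]%N.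
Proof.
have := ltn_ord u; have := ltn_ord v; rewrite /block_edge => vn un; congr (_ && _).
apply/existsP/idP => [[[[|[|//]] j] /=]|]; try lia.
by case/orP=> H; [exists (Ordinal (isT : 0 < 2)%N) | exists (Ordinal (isT : 1 < 2)%N)] => /=; lia.
Qed.

Lemma block_edge1 k (u v : 'I_k) :
  block_edge [:: k] u v = (u != v :> nat) && (u + v == k.-1)%N.
Proof.
have := ltn_ord u; have := ltn_ord v; rewrite /block_edge => vn un; congr (_ && _).
apply/existsP/idP => [[[[|//] j] /=]|]; try lia.
by move=> H; exists (Ordinal (isT : 0 < 1)%N) => /=; lia.
Qed.

Variable k : nat.
Hypothesis k_def : k = (2 * m - 1)%N.

(** The three kinds of arcs: bottom arcs, top arcs in the block of size k, and the top arc of the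
    block of size 2. *)
Let nat_arc (u v : nat) :=
  [|| (u < m) && (u + v == 2 * m), [&& m <= u, u <= 2 * m - 2 & u + v == 2 * m - 2]
    | (u == 2 * m) && (v == 2 * m - 1)]%N.

Let nat_arc_position (u v : nat) : (u <= 2 * m)%N -> (v <= 2 * m)%N ->
  nat_arc u v = pos_arc (position u) (position v).
Proof.
move=> un vn; apply/idP/idP => [/or3P[] H|].
- have -> : v = (2 * m - u)%N by lia.
  by rewrite /pos_arc /position; do ![case: ifP] => *; lia.
- have -> : v = (2 * m - 2 - u)%N by lia.
  by rewrite /pos_arc /position; do ![case: ifP] => *; lia.
- have [-> ->] : u = (2 * m)%N /\ v = (2 * m - 1)%N by lia.
  by rewrite /pos_arc /position; do ![case: ifP] => *; lia.
rewrite -{2}(positionK un) -{2}(positionK vn).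
have := position_lt un; have := position_lt vn.
move: (position u) (position v) => s t {u v un vn} tn sn.
case/orP=> /andP[/eqP eqst H]; rewrite /nat_arc /vertex; subst.
  by do ![case: ifP] => *; lia.
by do ![case: ifP] => *; lia.
Qed.

Lemma arc_position (u v : 'I_(k + 2)) :
  Defs.arc [:: k; 2%N] [:: (k + 2)%N] u v = pos_arc (position u) (position v).
Proof.
have := ltn_ord u; have := ltn_ord v => vn un.
rewrite -nat_arc_position; try lia.
by rewrite /Defs.arc block_edge2 block_edge1 /nat_arc; move: (u : nat) (v : nat) un vn; lia.
Qed.
End Vertices.

(** * Walks without repetition on a line *)

Definition line_walk (s t : nat) : seq nat :=
  if (s <= t)%N then iota s.+1 (t - s) else rev (iota t (s - t)).

Definition line_adj : rel nat := fun s t => (s == t.+1) || (t == s.+1).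

Lemma line_walk_bound s t x : x \in line_walk s t -> (x <= maxn s t)%N.
Proof. by rewrite /line_walk; case: leqP => st; rewrite ?mem_rev mem_iota; lia. Qed.

Lemma line_walk_refl s : line_walk s s = [::].
Proof. by rewrite /line_walk leqnn subnn. Qed.

Lemma line_walk_up s t : (s < t)%N -> line_walk s t = s.+1 :: line_walk s.+1 t.
Proof. by move=> st; rewrite /line_walk (ltnW st) st -(subnSK st). Qed.

Lemma line_walk_down s t : (t <= s)%N -> line_walk s.+1 t = s :: line_walk s t.
Proof.
move=> ts; rewrite /line_walk leqNgt ltnS ts /= subSn // -addn1 iotaD rev_cat /= subnKC //.
case: (ltngtP s t) ts => // [ <-] _ ; rewrite ?subnn //.
Qed.

Lemma line_walk_path s t :
  [/\ path line_adj s (line_walk s t), uniq (s :: line_walk s t) &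
      last s (line_walk s t) = t].
Proof.
have up d : path line_adj s (iota s.+1 d) && (last s (iota s.+1 d) == s + d)%N.
  elim: d s => [|d IHd] s' /=; first by rewrite addn0 eqxx.
  by rewrite /line_adj eqxx orbT /= addnS -addSn; exact: IHd.
have down d : path line_adj (t + d)%N (line_walk (t + d) t) &&
    (last (t + d)%N (line_walk (t + d) t) == t).
  elim: d => [|d IHd]; first by rewrite addn0 line_walk_refl /= eqxx.
  rewrite addnS line_walk_down ?leq_addr //= -andbA IHd andbT.
  by rewrite /line_adj eqxx.
split.
- case: (leqP s t) => st; first by rewrite /line_walk st; case/andP: (up (t - s)%N).
  by case/andP: (down (s - t)%N); rewrite subnKC // ltnW.
- rewrite /= /line_walk; case: ifP => st.
    by rewrite iota_uniq mem_iota; lia.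
  by rewrite mem_rev rev_uniq iota_uniq mem_iota; lia.
case: (leqP s t) => st.
  by rewrite /line_walk st; case/andP: (up (t - s)%N) => _ /eqP->; rewrite subnKC.
by case/andP: (down (s - t)%N); rewrite subnKC ?(ltnW st) // => _ /eqP.
Qed.

(** A first step away from t is impossible: by induction the rest is the direct walk to t, which
    would pass through s again. *)
Lemma line_walk_unique s t p :
  path line_adj s p -> uniq (s :: p) -> last s p = t -> p = line_walk s t.
Proof.
elim: p s => [|x p IHp] s; first by move=> _ _ /= ->; rewrite line_walk_refl.
rewrite cons_uniq [path _ _ _]/= [last _ _]/=.
move=> /andP[sx xp] /andP[s_xp p_uniq] last_p.
move: s_xp; rewrite inE negb_or (IHp x) // => /andP[_].
case/orP: sx => /eqP ?; subst.
  case: (leqP (last x p) x) => [tx _|xt]; first by rewrite line_walk_down.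
  by rewrite line_walk_up // inE eqxx.
case: (leqP s.+1 (last s.+1 p)) => [st _|ts]; first by rewrite [RHS]line_walk_up.
by rewrite line_walk_down // inE eqxx.
Qed.

(** * Paths of the meander and their weights *)

Section Meander.
Variables (m k : nat).
Hypotheses (m_gt1 : (1 < m)%N) (k_def : k = (2 * m - 1)%N).
Local Notation n := (k + 2)%N.
Local Notation a := [:: k; 2%N].
Local Notation b := [:: (k + 2)%N].
Local Notation pos := (fun u : 'I_n => position m u).

Lemma pos_arc_line s t : (s <= 2 * m)%N -> (t <= 2 * m)%N ->
  pos_arc m s t || pos_arc m t s = line_adj s t.
Proof. by rewrite /pos_arc /line_adj; lia. Qed.

Lemma ord_le2m (u : 'I_n) : (u <= 2 * m)%N.
Proof. by have := ltn_ord u; lia. Qed.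

Lemma adjacent_pos (u v : 'I_n) : adjacent a b u v = line_adj (pos u) (pos v).
Proof.
rewrite /adjacent !(arc_position m_gt1 k_def) pos_arc_line //;
  exact: position_lt (ord_le2m _).
Qed.

Definition vertex_walk (i j : 'I_n) : seq 'I_n :=
  [seq insubd i (vertex m t) | t <- line_walk (pos i) (pos j)].

(** The map [pos] is injective and turns adjacency in the meander into adjacency on the line, where
    the walk is unique. *)
Lemma meander_pathP (i j : 'I_n) p :
  meander_path a b i p j <-> p = vertex_walk i j.
Proof.
have posI : injective pos.
  move=> u v /= /(congr1 (vertex m)).
  by rewrite !positionK ?ord_le2m // => /val_inj.
have pathE q : path (adjacent a b) i q = path line_adj (pos i) (map pos q).
  by rewrite (path_map (f := pos)); apply: eq_path => u v; exact: adjacent_pos.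
have uniqE q : uniq (i :: q) = uniq (pos i :: map pos q).
  by rewrite -(map_inj_uniq posI).
have lastE q : (last i q == j) = (last (pos i) (map pos q) == pos j).
  by rewrite (last_map pos) -(inj_eq posI).
rewrite /meander_path pathE uniqE lastE; split.
  case/and3P=> pp pu /eqP pl; rewrite /vertex_walk -(line_walk_unique pp pu pl).
  rewrite -map_comp -[LHS]map_id; apply: eq_map => u /=.
  by apply: val_inj; rewrite positionK ?ord_le2m // insubdK // unfold_in ltn_ord.
move=> ->; have -> : map pos (vertex_walk i j) = line_walk (pos i) (pos j).
  rewrite /vertex_walk -map_comp -[RHS]map_id; apply/eq_in_map => t tw /=.
  have tm : (t <= 2 * m)%N.
    have := line_walk_bound tw; have := position_lt m_gt1 (ord_le2m i).
    by have := position_lt m_gt1 (ord_le2m j); lia.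
  rewrite insubdK ?vertexK // unfold_in; have := vertex_lt m_gt1 tm; lia.
by have [-> -> ->] := line_walk_path (pos i) (pos j); rewrite eqxx.
Qed.

Lemma arc_height (u v : 'I_n) : Defs.arc a b u v -> height m v = (height m u).+1.
Proof.
have := position_lt m_gt1 (ord_le2m u); have := position_lt m_gt1 (ord_le2m v).
by rewrite (arc_position m_gt1 k_def) /pos_arc /height /pos_height;
  do ![case: ifP] => *; lia.
Qed.

Lemma step_weight_height (u v : 'I_n) : adjacent a b u v ->
  step_weight a b u v = (height m v)%:Z - (height m u)%:Z.
Proof.
rewrite /adjacent /step_weight; case uv: (Defs.arc a b u v).
  have := arc_height uv; case vu: (Defs.arc a b v u); last by lia.
  by have := arc_height vu; lia.
by case vu: (Defs.arc a b v u) => // _; have := arc_height vu; lia.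
Qed.

(** Every step changes the height by its own weight, so the sum telescopes. *)
Lemma weight_height (i : 'I_n) p : path (adjacent a b) i p ->
  weight a b i p = (height m (last i p))%:Z - (height m i)%:Z.
Proof.
rewrite /weight; elim: p i => [|x p IHp] i /=; first by rewrite big_nil subrr.
by case/andP=> ix xp; rewrite big_cons /= IHp // step_weight_height //; lia.
Qed.

Lemma has_extended_spectrum_height (E : {mset int}%mset) :
  E = (seq_mset [seq (height m j)%:Z - (height m i)%:Z
                | i : 'I_n <- enum 'I_n, j : 'I_n <- enum 'I_n] `\ 0)%mset ->
  has_extended_spectrum n a b E.
Proof.
move=> ->; exists vertex_walk; first exact: meander_pathP.
congr (seq_mset _ `\ 0)%mset; apply: eq_allpairs => i j.
have /and3P[ip _ /eqP ij] := (meander_pathP i j _).2 erefl.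
by rewrite weight_height // ij.
Qed.
End Meander.

(** * Differences of heights *)

Section HeightSums.
Variables (m k : nat).
Hypotheses (m_gt1 : (1 < m)%N) (k_def : k = (2 * m - 1)%N).
Local Notation n := (k + 2)%N.

Lemma sum_position (P : pred nat) (G : nat -> nat) :
  (\sum_(i < n | P i) G (position m i) =
   \sum_(t <- iota 0 (2 * m + 1) | P (vertex m t)) G t)%N.
Proof.
have le2m (u : 'I_n) : (u <= 2 * m)%N by have := ltn_ord u; lia.
have perm_pos : perm_eq (iota 0 (2 * m + 1)) [seq position m i | i : 'I_n <- index_enum 'I_n].
  apply: uniq_perm; first exact: iota_uniq.
    rewrite map_inj_uniq; first by rewrite /index_enum -enumT enum_uniq.
    move=> u v /(congr1 (vertex m)).
    by rewrite !positionK // => /val_inj.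
  move=> t; rewrite mem_iota; apply/idP/mapP => [tm|[u _ ->]].
    have tm' : (t <= 2 * m)%N by lia.
    have vn : (vertex m t < n)%N by have := vertex_lt m_gt1 tm'; lia.
    by exists (Ordinal vn); rewrite ?mem_index_enum //= vertexK.
  by have := position_lt m_gt1 (le2m u); lia.
rewrite (perm_big _ perm_pos) big_map /=.
by apply: eq_bigl => i; rewrite positionK.
Qed.

(** The vertices below k occupy the positions 0, ..., m - 1, of the same heights, and m + 2, ..., 2
    m, of heights m, ..., 2. *)
Lemma sum_height_low (G : nat -> nat) :
  (\sum_(i < n | i < k) G (height m i) =
   \sum_(h <- iota 0 m) G h + \sum_(h <- iota 2 (m - 1)) G h)%N.
Proof.
rewrite (sum_position (fun i => i < k)%N (fun t => G (pos_height m t))).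
have -> : (2 * m + 1 = m + (2 + (m - 1)))%N by lia.
rewrite !iotaD !big_cat /= add0n !big_cons big_nil.
have low t : (t <= 2 * m)%N -> (vertex m t < k)%N = (t != m) && (t != m + 1)%N.
  by move=> tm; rewrite ltnNge k_def vertex_low // negb_or.
rewrite !low; try lia.
rewrite eqxx addn1 eqxx andbF /= add0n; congr (_ + _)%N.
  rewrite big_seq_cond [RHS]big_seq; apply: eq_big => t.
    by rewrite mem_iota; case: (t < m)%N / ltnP => tm; rewrite ?andbF // low; lia.
  by rewrite mem_iota /pos_height => tm; rewrite ifT //; lia.
have perm_h : perm_eq (iota 2 (m - 1)) [seq pos_height m t | t <- iota (m + 2) (m - 1)].
  apply: uniq_perm; first exact: iota_uniq.
    rewrite map_inj_in_uniq ?iota_uniq // => s t; rewrite !mem_iota /pos_height.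
    by do ![case: ifP] => *; lia.
  move=> h; rewrite mem_iota; apply/idP/mapP => [hm|[t]].
    by exists (2 * m + 2 - h)%N; rewrite ?mem_iota /pos_height; [lia|case: ifP => *; lia].
  by rewrite mem_iota /pos_height; case: ifP => *; lia.
rewrite (perm_big _ perm_h) big_map big_seq_cond [RHS]big_seq; apply: eq_bigl => t.
by rewrite mem_iota; case: (boolP (_ <= t < _)%N) => // tm; rewrite low; lia.
Qed.

Lemma sum_height_high (G : nat -> nat) :
  (\sum_(i < n | k <= i) G (height m i) = G m + G m.+1)%N.
Proof.
rewrite (sum_position (fun i => k <= i)%N (fun t => G (pos_height m t))).
have high t : (t <= 2 * m)%N -> (k <= vertex m t)%N = (t == m) || (t == m + 1)%N.
  by move=> tm; rewrite k_def vertex_low.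
have -> : (2 * m + 1 = m + (2 + (m - 1)))%N by lia.
rewrite !iotaD !big_cat /= add0n !big_cons big_nil !high; try lia.
rewrite eqxx addn1 eqxx orbT /= big_seq_cond big_pred0 => [|t]; last first.
  by rewrite mem_iota; case: (boolP (_ <= t < _)%N) => // tm; rewrite high; lia.
rewrite big_seq_cond big_pred0 => [|t]; last first.
  by rewrite mem_iota; case: (boolP (_ <= t < _)%N) => // tm; rewrite high; lia.
by rewrite /pos_height !ifT; lia.
Qed.

Lemma sum_height (G : nat -> nat) :
  (\sum_(i < n) G (height m i) =
   \sum_(h <- iota 0 (m + 2)) G h + \sum_(h <- iota 2 (m - 1)) G h)%N.
Proof.
rewrite (bigID (fun i : 'I_n => i < k)%N) /= sum_height_low iotaD big_cat /= add0n.
under [X in (_ + X)%N]eq_bigl do rewrite -leqNgt.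
by rewrite sum_height_high !big_cons big_nil; lia.
Qed.

End HeightSums.

(** The count of pairs is the length of the intersection of [b, b + q) with the translate [a + z, a
    + p + z). *)
Lemma sum_iota_diff (a p b q : nat) (z : int) :
  (\sum_(x <- iota a p) \sum_(y <- iota b q) (y%:Z - x%:Z == z)%R)%N%:Z =
  Num.max 0 (Num.min (b + q)%N%:Z ((a + p)%N%:Z + z) - Num.max b%:Z (a%:Z + z)).
Proof.
have inner (x : nat) r : (\sum_(y <- iota b r) (y%:Z - x%:Z == z)%R)%N =
    (b%:Z <= x%:Z + z < (b + r)%N%:Z)%R :> nat.
  elim: r => [|r IHr]. by rewrite big_nil; lia.
  by rewrite -addn1 iotaD big_cat IHr /= big_cons big_nil; clear; lia.
elim: p => [|p IHp]. by rewrite big_nil; lia.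
rewrite -addn1 iotaD big_cat [LHS]PoszD IHp /= big_cons big_nil inner.
clear IHp inner.
by lia.
Qed.

(** * Multiplicities of the height differences *)

Section HeightDifferences.

Lemma big_msetDE (T : choiceType) (l r : nat) (F : nat -> {mset T}%mset) z :
  ((\big[msetD/mset0]_(l <= i < r) F i)%mset z = \sum_(l <= i < r) F i z)%N.
Proof.
elim/big_rec2: _ => [|i x A _ IH]; first by rewrite mset0E.
by rewrite msetE2 IH.
Qed.

Lemma sum_nat_single (l r : nat) (c : nat -> nat) (w : int) :
  (\sum_(l <= i < r) (if w == i%:Z then c i else 0) =
   if (l%:Z <= w < r%:Z)%R then c `|w| else 0)%N.
Proof.
have [lr|rl] := leqP l r; last by rewrite big_geq 1?ltnW //; case: ifP => //; lia.
rewrite -(subnKC lr); elim: (r - l)%N => [|d IHd].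
  by rewrite addn0 big_geq //; case: ifP => //; lia.
rewrite addnS big_nat_recr ?leq_addr //= IHd.
case: eqVneq => [->|wd].
  by rewrite absz_nat; do ![case: ifP]; lia.
by rewrite addn0; do ![case: ifP] => //; lia.
Qed.

Lemma count_allpairs_sum (n : nat) (f : 'I_n -> 'I_n -> int) z :
  count_mem z [seq f i j | i <- enum 'I_n, j <- enum 'I_n] =
  (\sum_i \sum_j (f i j == z)%R)%N.
Proof.
rewrite -sum1_count big_mkcond big_allpairs_dep /= big_enum /=.
apply: eq_bigr => i _; rewrite big_enum /=; apply: eq_bigr => j _.
by case: eqP.
Qed.

Variables (m k : nat).
Hypotheses (m_gt1 : (1 < m)%N) (k_def : k = (2 * m - 1)%N).
Local Notation n := (k + 2)%N.

Lemma sum_height_diff z :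
  (\sum_(i < n) \sum_(j < n) ((height m j)%:Z - (height m i)%:Z == z)%R =
   \sum_(x <- iota 0 (m + 2)) \sum_(y <- iota 0 (m + 2)) (y%:Z - x%:Z == z)%R
   + \sum_(x <- iota 0 (m + 2)) \sum_(y <- iota 2 (m - 1)) (y%:Z - x%:Z == z)%R
   + \sum_(x <- iota 2 (m - 1)) \sum_(y <- iota 0 (m + 2)) (y%:Z - x%:Z == z)%R
   + \sum_(x <- iota 2 (m - 1)) \sum_(y <- iota 2 (m - 1)) (y%:Z - x%:Z == z)%R)%N.
Proof.
etransitivity.
  apply: eq_bigr => i _.
  exact: (sum_height m_gt1 k_def (fun y => y%:Z - (height m i)%:Z == z)%R).
etransitivity.
  exact: (sum_height m_gt1 k_def (fun x =>
    \sum_(y <- iota 0 (m + 2)) (y%:Z - x%:Z == z)%R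
    + \sum_(y <- iota 2 (m - 1)) (y%:Z - x%:Z == z)%R)%N).
by rewrite !big_split /= !addnA.
Qed.

(** These pairs index the lower left block, which vanishes on the seaweed; their differences belong
    to the extended spectrum only. *)
Lemma sum_height_diff_excluded z :
  (\sum_(i < n | k <= i) \sum_(j < n | j < k) ((height m j)%:Z - (height m i)%:Z == z)%R =
   \sum_(x <- iota m 2) \sum_(y <- iota 0 m) (y%:Z - x%:Z == z)%R
   + \sum_(x <- iota m 2) \sum_(y <- iota 2 (m - 1)) (y%:Z - x%:Z == z)%R)%N.
Proof.
etransitivity.
  apply: eq_bigr => i _.
  exact: (sum_height_low m_gt1 k_def (fun y => y%:Z - (height m i)%:Z == z)%R).
etransitivity.
  exact: (sum_height_high m_gt1 k_def (fun x =>
    \sum_(y <- iota 0 m) (y%:Z - x%:Z == z)%R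
    + \sum_(y <- iota 2 (m - 1)) (y%:Z - x%:Z == z)%R)%N).
by rewrite !big_cons !big_nil !addn0; lia.
Qed.

(** For m = 2 the indexed union is empty here and in [spectrum_mset], so the case k = 3 is an
    instance of the same formulas. *)
Definition extended_mset : {mset int}%mset :=
      ((@msetn int 1 (- m%:R - 1) `+` @msetn int 3 (- m%:R)
        `+` @msetn int (2 * k - 1) (- 1) `+` @msetn int (2 * k) 0
        `+` @msetn int (2 * k - 1) 1
        `+` @msetn int 3 m%:R `+` @msetn int 1 (m%:R + 1))
       `+` \big[msetD/mset0]_(1 <= i < m.-1)
             (@msetn int (4 * i + 2) (- m%:R + i%:R)
              `+` @msetn int (4 * i + 2) (m%:R - i%:R)))%mset.

Definition spectrum_mset : {mset int}%mset :=
      ((@msetn int 1 (- m%:R) `+` @msetn int 3 (- m%:R + 1)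
        `+` @msetn int (2 * k - 1) 0 `+` @msetn int (2 * k - 1) 1
        `+` @msetn int 3 m%:R `+` @msetn int 1 (m%:R + 1))
       `+` \big[msetD/mset0]_(2 <= i < m)
             (@msetn int (4 * i - 2) (- m%:R + i%:R)
              `+` @msetn int (4 * i - 2) (m%:R - i%:R + 1)))%mset.

Lemma extended_msetE (z : int) : extended_mset z =
  (\sum_(i < n) \sum_(j < n) ((height m j)%:Z - (height m i)%:Z == z)%R - (z == 0%R))%N.
Proof.
rewrite /extended_mset !msetE2 !msetnE big_msetDE sum_height_diff.
(* For a given z at most one index i contributes to each half of the union, namely z + m and m -
   z. *)
have -> : (\sum_(1 <= i < m.-1) ((@msetn int (4 * i + 2) (- m%:R + i%:R)%R
              `+` @msetn int (4 * i + 2) (m%:R - i%:R)%R) z)%mset)%N =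
  ((if (1 <= z + m%:Z < m.-1%:Z)%R then 4 * absz (z + m%:Z)%R + 2 else 0) +
   (if (1 <= m%:Z - z < m.-1%:Z)%R then 4 * absz (m%:Z - z)%R + 2 else 0))%N.
  rewrite -!(sum_nat_single 1 m.-1 (fun i => 4 * i + 2)%N) -big_split /=.
  apply: eq_bigr => i _; rewrite msetE2 !msetnE.
  by congr ((if _ then _ else _) + (if _ then _ else _))%N; apply/eqP/eqP; lia.
rewrite !natz; do 9 (case: ifP => ?; try (exfalso; lia)).
(* The double sums become lengths of intersections of intervals, which leaves linear arithmetic in
   each case. *)
all: have := sum_iota_diff 0 (m + 2) 0 (m + 2) z.
all: have := sum_iota_diff 0 (m + 2) 2 (m - 1) z.
all: have := sum_iota_diff 2 (m - 1) 0 (m + 2) z.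
all: have := sum_iota_diff 2 (m - 1) 2 (m - 1) z.
all: do 4 move: (\sum_(x <- _) _)%N => ?.
all: repeat (case: lerP => ?; try (exfalso; lia)).
all: lia.
Qed.
End HeightDifferences.

Section SpectrumMset.
Variables (m k : nat).
Hypotheses (m_gt1 : (1 < m)%N) (k_def : k = (2 * m - 1)%N).
Local Notation n := (k + 2)%N.

(** From all differences one removes those of the vanishing block and one 0 for the trace condition.
    The additive form avoids truncated subtraction. *)
Lemma spectrum_msetE (z : int) : (spectrum_mset m k z + 
  \sum_(i < n | k <= i) \sum_(j < n | j < k) ((height m j)%:Z - (height m i)%:Z == z)%R
  + (z == 0%R) =
  \sum_(i < n) \sum_(j < n) ((height m j)%:Z - (height m i)%:Z == z)%R)%N.
Proof.
rewrite /spectrum_mset !msetE2 !msetnE big_msetDE sum_height_diff // sum_height_diff_excluded //.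
have -> : (\sum_(2 <= i < m) ((@msetn int (4 * i - 2) (- m%:R + i%:R)%R
              `+` @msetn int (4 * i - 2) (m%:R - i%:R + 1)%R) z)%mset)%N =
  ((if (2 <= z + m%:Z < m%:Z)%R then 4 * absz (z + m%:Z)%R - 2 else 0) +
   (if (2 <= m%:Z + 1 - z < m%:Z)%R then 4 * absz (m%:Z + 1 - z)%R - 2 else 0))%N.
  rewrite -!(sum_nat_single 2 m (fun i => 4 * i - 2)%N) -big_split /=.
  apply: eq_bigr => i _; rewrite msetE2 !msetnE.
  by congr ((if _ then _ else _) + (if _ then _ else _))%N; apply/eqP/eqP; lia.
rewrite !natz; do 8 (case: ifP => ?; try (exfalso; lia)).
all: have := sum_iota_diff 0 (m + 2) 0 (m + 2) z.
all: have := sum_iota_diff 0 (m + 2) 2 (m - 1) z.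
all: have := sum_iota_diff 2 (m - 1) 0 (m + 2) z.
all: have := sum_iota_diff 2 (m - 1) 2 (m - 1) z.
all: have := sum_iota_diff m 2 0 m z.
all: have := sum_iota_diff m 2 2 (m - 1) z.
all: do 6 move: (\sum_(x <- _) _)%N => ?.
all: repeat (case: lerP => ?; try (exfalso; lia)).
all: lia.
Qed.

End SpectrumMset.

Lemma count_map_enum (T : finType) (A : {pred T}) (f : T -> int) z :
  count_mem z [seq f p | p <- enum A] = (\sum_(p in A) (f p == z)%R)%N.
Proof.
rewrite -sum1_count big_mkcond big_map big_enum /=.
by apply: eq_bigr => p _; case: eqP.
Qed.

Section AllowedPairs.
Variables (m k : nat).
Hypotheses (m_gt1 : (1 < m)%N) (k_def : k = (2 * m - 1)%N).
Local Notation n := (k + 2)%N.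

Definition allowed (p : 'I_n * 'I_n) := ~~ ((k <= p.1) && (p.2 < k))%N.

(** The 0 lost to the trace condition is removed by deleting the diagonal pair (o, o). *)
Lemma spectrum_mset_allowed (o : 'I_n) :
  (o < k)%N ->
  spectrum_mset m k = seq_mset [seq (height m p.2)%:Z - (height m p.1)%:Z
    | p : 'I_n * 'I_n <- enum [pred p : 'I_n * 'I_n | allowed p && (p != (o, o))]].
Proof.
move=> ok; apply/msetP => z; rewrite mset_seqE count_map_enum.
have := spectrum_msetE m_gt1 k_def z.
rewrite pair_big pair_bigA /= [RHS](bigID (fun p : 'I_n * 'I_n => (k <= p.1) && (p.2 < k))%N) /=.
rewrite (bigD1 (o, o) (P := fun p : 'I_n * 'I_n => ~~ _)) /=; last by rewrite ok andbT -ltnNge.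
by rewrite subrr -addnA addnCA [0 == z]eq_sym => /addnI; rewrite addnC => /addnI.
Qed.
End AllowedPairs.

(** * Integer multisets mapped into a ring *)

Section IntrMset.
Variable K : nzRingType.

Definition intr_mset (A : {mset int}%mset) : {mset K}%mset :=
  seq_mset [seq z%:~R | z <- (A : seq int)].

Lemma intr_mset_seq (s : seq int) : intr_mset (seq_mset s) = seq_mset [seq z%:~R | z <- s].
Proof. by apply/eq_seq_msetP/perm_map/perm_eq_seq_mset. Qed.

Lemma intr_msetD A B : intr_mset (A `+` B)%mset = (intr_mset A `+` intr_mset B)%mset.
Proof.
rewrite /intr_mset; apply/msetP=> c; rewrite msetE2 !mset_seqE -count_cat -map_cat.
apply/permP/perm_map; apply/allP=> z _ /=; apply/eqP.
by rewrite count_cat !count_mem_mset msetE2.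
Qed.

Lemma intr_msetn n z : intr_mset (msetn n z) = msetn n z%:~R.
Proof.
rewrite /intr_mset enum_msetn map_nseq; apply/msetP=> c.
by rewrite mset_seqE msetnE count_nseq /= eq_sym; case: eqP; rewrite ?mul1n.
Qed.

Lemma intr_mset0 : intr_mset mset0 = mset0.
Proof. by rewrite /intr_mset enum_mset0; apply/msetP=> c; rewrite mset_seqE mset0E. Qed.

Lemma intr_mset_big l r (F : nat -> {mset int}%mset) :
  intr_mset (\big[msetD/mset0]_(l <= i < r) F i)%mset =
  (\big[msetD/mset0]_(l <= i < r) intr_mset (F i))%mset.
Proof. exact: (big_morph intr_mset intr_msetD intr_mset0). Qed.

Lemma intr_spectrum_mset m k : intr_mset (spectrum_mset m k) =
      ((@msetn K 1 (- m%:R) `+` @msetn K 3 (- m%:R + 1)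
        `+` @msetn K (2 * k - 1) 0 `+` @msetn K (2 * k - 1) 1
        `+` @msetn K 3 m%:R `+` @msetn K 1 (m%:R + 1))
       `+` \big[msetD/mset0]_(2 <= i < m)
             (@msetn K (4 * i - 2) (- m%:R + i%:R)
              `+` @msetn K (4 * i - 2) (m%:R - i%:R + 1)))%mset.
Proof.
rewrite /spectrum_mset !intr_msetD intr_mset_big !intr_msetn.
rewrite !(rmorphD, rmorphN, rmorph_nat, rmorph0, rmorph1) /=.
congr (_ `+` _)%mset; apply: eq_bigr => i _.
by rewrite intr_msetD !intr_msetn !(rmorphD, rmorphN, rmorph_nat, rmorph1).
Qed.
End IntrMset.

(** * The meander form *)

(* Y is a matrix of the seaweed with rows and columns indexed by positions on the
   path.  [block0] is the vanishing of its lower left block, and [shiftE] says that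
   it commutes with the matrix of the arcs outside the upper right block. *)
Section MeanderCentralizer.
Variables (K : zmodType) (m : nat) (Y : nat -> nat -> K).
Hypothesis m_gt1 : (1 < m)%N.

Let tail (s : nat) := (s == m) || (s == m.+1).

(** Entry (s, t) of the arc matrix times Y: the sum of Y r t over the arcs from r to s. Likewise
    [shift_col] is Y times the arc matrix, the sum of Y s r over the arcs from t to r. *)
Definition shift_row (s t : nat) : K :=
  (if (0 < s <= m.+1)%N then Y s.-1 t else 0)
  + (if (m < s < 2 * m)%N then Y s.+1 t else 0).

Definition shift_col (s t : nat) : K :=
  (if (t <= m)%N then Y s t.+1 else 0) + (if (m.+1 < t)%N then Y s t.-1 else 0).

Hypothesis block0 : forall s t, (s <= 2 * m)%N -> (t <= 2 * m)%N ->
  tail s -> ~~ tail t -> Y s t = 0.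
Hypothesis shiftE : forall s t, (s <= 2 * m)%N -> (t <= 2 * m)%N ->
  tail s || ~~ tail t -> shift_row s t = shift_col s t.

Ltac decide_ifs := repeat first
  [rewrite ifT; last by lia | rewrite ifF; last by lia]; rewrite ?addr0 ?add0r /=.
Ltac use_shift s t :=
  have := @shiftE s t; rewrite /shift_row /shift_col /tail; decide_ifs.

(** The equations [shiftE] carry entries along diagonals when both indices lie on the same arm of
    the path, and along antidiagonals otherwise. Every off-diagonal entry is carried to a boundary
    row or to a zero of [block0], and the diagonal entries all agree. *)
Lemma centralizer_scalar s t : (s <= 2 * m)%N -> (t <= 2 * m)%N ->
  Y s t = Y 0%N 0%N *+ (s == t).
Proof.
have zero s' t' : (s' == m) || (s' == m.+1) -> (t' <= 2 * m)%N ->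
    (t' < m)%N || (m.+1 < t')%N -> Y s' t' = 0.
  by move=> s'm t'm t'r; apply: block0; rewrite /tail; lia.
have top t' : (t' < m)%N -> Y 0%N t'.+1 = 0.
  by move=> tm; use_shift 0%N t' => <- //; lia.
have diag s' t' : (s' < m)%N -> (t' < m)%N -> Y s'.+1 t'.+1 = Y s' t'.
  by move=> sm tm; use_shift s'.+1 t' => <- //; lia.
have merge t' : (t' < m)%N -> Y m.+1 t'.+1 = Y m t' + Y m.+2 t'.
  by move=> tm; use_shift m.+1 t' => <- //; lia.
have anti s' t' : (m.+2 <= s' < 2 * m)%N -> (t' < m)%N -> Y s' t'.+1 = Y s'.+1 t'.
  by move=> sm tm; use_shift s' t' => <- //; lia.
have bottom t' : (t' < m)%N -> Y (2 * m)%N t'.+1 = 0.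
  by move=> tm; use_shift (2 * m)%N t' => <- //; lia.
have mm1 : Y m m.+1 = Y m.-1 m by use_shift m m => <- //; lia.
have m1m1 : Y m.+1 m.+1 = Y m m + Y m.+2 m by use_shift m.+1 m => <- //; lia.
have m0m1 : Y m.-1 m.+1 = 0 by use_shift m m.+1 => -> //; lia.
have top2 t' : (m.+2 <= t' <= 2 * m)%N -> Y 0%N t'.-1 = 0.
  by move=> tm; use_shift 0%N t' => <- //; lia.
have anti2 s' t' : (s' < m)%N -> (m.+2 <= t' <= 2 * m)%N -> Y s'.+1 t'.-1 = Y s' t'.
  by move=> sm tm; use_shift s'.+1 t' => <- //; lia.
have diag2 s' t' : (m < s' < 2 * m)%N -> (m.+2 <= t' <= 2 * m)%N -> Y s'.+1 t' = Y s' t'.-1.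
  move=> sm tm; have [->|s'm] := eqVneq s' m.+1.
    use_shift m.+1 t' => <- //; try lia.
    by rewrite (zero m) ?add0r //; lia.
  by use_shift s' t' => <- //; lia.
have bottom2 t' : (m.+2 <= t' <= 2 * m)%N -> Y (2 * m)%N t'.-1 = 0.
  by move=> tm; use_shift (2 * m)%N t' => <- //; lia.
have upper i : forall j, (i < j <= m)%N -> Y i j = 0.
  elim: i => [|i IHi] [|j] // ij; first by apply: top; lia.
  by rewrite diag; try lia; apply: IHi; lia.
have diagonal i : (i <= m)%N -> Y i i = Y 0%N 0%N.
  by elim: i => // i IHi im; rewrite diag; try lia; apply: IHi; lia.
have lower d : forall i j, (i + d = m)%N -> (j < i)%N -> Y i j = 0.
  elim: d => [|d IHd] i j id ij; first by apply: zero; lia.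
  by rewrite -diag; try lia; apply: IHd; lia.
have south d : forall i j, (i + d = 2 * m)%N -> (m.+2 <= i)%N ->
    (2 * m < i + j)%N -> (j <= m)%N -> Y i j = 0.
  elim: d => [|d IHd] i [|j] // id im ij jm; try lia.
    have -> : i = (2 * m)%N by lia.
    by apply: bottom; lia.
  by rewrite anti; try lia; apply: IHd; lia.
(* The antidiagonal is followed up to row m + 2, where [merge] expresses the entry through two
   entries in the rows m and m + 1, both zero by [block0]. *)
have north d : forall i j, (i = m.+2 + d)%N -> (i + j <= 2 * m)%N -> Y i j = 0.
  elim: d => [|d IHd] i j id ij.
    have -> : i = m.+2 by lia.
    have H : Y m.+1 j.+1 = Y m j + Y m.+2 j by apply: merge; lia.
    by rewrite (zero m) ?add0r in H; try lia; rewrite -H; apply: zero; lia.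
  have -> : i = i.-1.+1 by lia.
  by rewrite -anti; try lia; apply: IHd; lia.
have below i j : (m.+2 <= i <= 2 * m)%N -> (j <= m)%N -> Y i j = 0.
  move=> im jm; have [ij|ij] := leqP (i + j) (2 * m).
    by apply: (north (i - m.+2)%N); lia.
  by apply: (south (2 * m - i)%N); lia.
have m1m : Y m.+1 m = 0.
  have -> : Y m.+1 m = Y m m.-1 + Y m.+2 m.-1 by rewrite -merge ?prednK //; lia.
  by rewrite (zero m) ?add0r; try lia; apply: below; lia.
have upper2 d : forall i j, (i = m.+1 + d)%N -> (i < j <= 2 * m)%N -> Y i j = 0.
  elim: d => [|d IHd] i j id ij; first by apply: zero; lia.
  have -> : i = i.-1.+1 by lia.
  by rewrite diag2; try lia; apply: IHd; lia.
(* The equation [m1m1] at the sink links the diagonals of the two arms. *)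
have diagonal2 d : (m.+1 + d <= 2 * m)%N -> Y (m.+1 + d)%N (m.+1 + d)%N = Y 0%N 0%N.
  elim: d => [|d IHd] dm; first by rewrite addn0 m1m1 diagonal // (below m.+2) ?addr0 //; lia.
  by rewrite addnS diag2 /=; try lia; apply: IHd; lia.
have lower2 d : forall i j, (i + d = 2 * m)%N -> (m < j < i)%N -> Y i j = 0.
  elim: d => [|d IHd] i j id ij.
    have -> : i = (2 * m)%N by lia.
    by have := @bottom2 j.+1; apply; lia.
  by have := @diag2 i j.+1; rewrite /= => <-; try lia; apply: IHd; lia.
have corner i : forall j, (m < j)%N -> (i + j < 2 * m)%N -> Y i j = 0.
  elim: i => [|i IHi] j jm ij; first by have := @top2 j.+1; apply; lia.
  by have := @anti2 i j.+1; rewrite /= => ->; try lia; apply: IHi; lia.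
(* The antidiagonal is followed down to row m; when it meets column m + 1 first, [m0m1] applies
   instead. *)
have corner2 d : forall i j, (i + d = m)%N -> (m < j <= 2 * m)%N ->
    (2 * m <= i + j)%N -> Y i j = 0.
  elim: d => [|d IHd] i j id jm ij.
    have -> : i = m by lia.
    have [->|j_m] := eqVneq j m.+1; last by apply: zero; lia.
    by rewrite mm1 upper //; lia.
  have [jE|j_m] := eqVneq j m.+1; last by rewrite -anti2; try lia; apply: IHd; lia.
  have -> : i = m.-1 by lia.
  by rewrite jE.
move=> sm tm; have [<-|st] := eqVneq s t.
  case: (leqP s m) => s_m; first by rewrite diagonal.
  by have := @diagonal2 (s - m.+1)%N; rewrite subnKC //; apply; lia.
rewrite mulr0n; case: (leqP s m) (leqP t m) => s_m [] t_m.
- case: (ltngtP s t) st => // st _; first by apply: upper; lia.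
  by apply: (lower (m - s)%N); lia.
- case: (ltnP (s + t) (2 * m)) => ij; first exact: corner.
  by apply: (corner2 (m - s)%N); lia.
- have [->|s_m1] := eqVneq s m.+1; last by apply: below; lia.
  by have [->|t_m1] := eqVneq t m; [exact: m1m | apply: zero; lia].
- case: (ltngtP s t) st => // st _; first by apply: (upper2 (s - m.+1)%N); lia.
  by apply: (lower2 (2 * m - s)%N); lia.
Qed.
End MeanderCentralizer.

(** * The seaweed as a maximal parabolic subalgebra *)

Section Parabolic.
Variable K : fieldType.

Lemma mem_span_basis_vec n (P : pred 'I_n) (v : 'cV[K]_n) :
  v \in <<[seq basis_vec K i | i <- enum 'I_n & P i]>>%VS <->
  forall i, ~~ P i -> v i 0 = 0.
Proof.
split=> [|v0].
  set X := [seq _ | i <- _ & _] => vX i Pi.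
  rewrite (coord_span (X := in_tuple X) vX) summxE big1 // => j _.
  have : X`_j \in X by rewrite mem_nth.
  case/mapP=> l; rewrite mem_filter => /andP[Pl _] ->.
  rewrite !mxE eqxx andbT; case: eqVneq => [il|_]; last by rewrite mulr0.
  by rewrite il Pl in Pi.
have -> : v = \sum_i v i 0 *: basis_vec K i.
  apply/colP=> i; rewrite summxE (bigD1 i) //= !mxE !eqxx mulr1 big1 ?addr0 // => j ji.
  by rewrite !mxE eq_sym (negPf ji) mulr0.
apply: rpred_sum => i _; have [Pi|/v0->] := boolP (P i); last by rewrite scale0r mem0v.
by apply/rpredZ/memv_span/map_f; rewrite mem_filter Pi mem_enum.
Qed.

Lemma preserves_span_basis_vec n (P : pred 'I_n) (x : 'M[K]_n) :
  preserves x <<[seq basis_vec K i | i <- enum 'I_n & P i]>>%VS <->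
  forall i j, ~~ P i -> P j -> x i j = 0.
Proof.
split=> [xP i j Pi Pj | x0 v /mem_span_basis_vec v0].
  have /xP/mem_span_basis_vec/(_ i Pi) :
      basis_vec K j \in <<[seq basis_vec K i | i <- enum 'I_n & P i]>>%VS.
    by apply/memv_span/map_f; rewrite mem_filter Pj mem_enum.
  by rewrite /basis_vec -colE mxE.
apply/mem_span_basis_vec => i Pi; rewrite mxE big1 // => j _.
by have [Pj|/v0->] := boolP (P j); rewrite ?mulr0 // x0 ?mul0r.
Qed.

(** The only proper nonzero member of the two flags is the span of the first k basis vectors. *)
Lemma mem_seaweed_parabolic k (x : 'M[K]_(k + 2)) :
  x \in seaweed K (k + 2) [:: k; 2%N] [:: (k + 2)%N] <->
  \tr x = 0 /\ forall i j : 'I_(k + 2), (k <= i)%N -> (j < k)%N -> x i j = 0.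
Proof.
rewrite mem_seaweed; split=> [[trx xV _]|[trx x0]].
  split=> // i j ki jk.
  have /preserves_span_basis_vec xV1 := xV 1%N isT.
  by apply: xV1; rewrite /= addn0 -?leqNgt.
split=> // [[|[|[|//]]]|[|[|//]]] _; apply/preserves_span_basis_vec => i j /=;
  rewrite ?addn0 //.
- by rewrite -leqNgt; exact: x0.
- by rewrite ltn_ord.
- by move=> _; rewrite leqNgt ltn_ord.
Qed.
End Parabolic.

Lemma sum_ord_at (V : nmodType) (N i : nat) (c : V) :
  \sum_(r < N) (if r == i :> nat then c else 0) = if (i < N)%N then c else 0.
Proof. by rewrite -big_mkcond (big_ord1_eq _ (fun=> c)). Qed.

(** * The radical of the meander form *)

Section MeanderForm.
Variables (K : fieldType) (m k : nat).
Hypotheses (m_gt1 : (1 < m)%N) (k_def : k = (2 * m - 1)%N).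
Hypothesis char0 : forall n, n.+1%:R != 0 :> K.
Local Notation n := (k + 2)%N.
Local Notation a := [:: k; 2%N].
Local Notation b := [:: (k + 2)%N].
Local Notation g := (seaweedLie K n a b).

(** The indices are transposed so that the trace against x sums x_(u,v) over the arcs u -> v. *)
Definition meander_mx : 'M[K]_n := \matrix_(v, u) (Defs.arc a b u v)%:R.

Definition meander_fun (x : g) : K^o := \tr (meander_mx *m \val x).

Lemma meander_fun_linear : linear meander_fun.
Proof.
move=> c x y; rewrite /meander_fun.
have -> : \val (c *: x + y) = c *: \val x + \val y by [].
by rewrite mulmxDr -scalemxAr linearD linearZ.
Qed.

Definition meander_form : 'Hom(g, K^o) :=
  linfun (HB.pack_for {linear g -> K^o} meander_fun
    (GRing.isLinear.Build K g K^o _ meander_fun meander_fun_linear)).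

Lemma meander_formE x : meander_form x = \tr (meander_mx *m \val x).
Proof. by rewrite lfunE. Qed.

Lemma n_neq0 : n%:R != 0 :> K. Proof. by rewrite addn2 char0. Qed.

Lemma commutator_trace (x y : 'M[K]_n) :
  \tr (meander_mx *m commutator x y) = \tr (commutator meander_mx x *m y).
Proof.
rewrite /commutator mulmxBr mulmxBl !linearB /= !mulmxA; congr (_ - _).
by rewrite mxtrace_mulC mulmxA.
Qed.

(* Scalar matrices do not contribute to brackets, so elementary matrices may be
   corrected by one to reach trace 0. *)
Lemma commutator_meander0 (x : g) : (forall y, meander_form (lie x y) = 0) ->
  forall i j : 'I_n, ~~ ((k <= j) && (i < k))%N -> commutator meander_mx (\val x) i j = 0.
Proof.
move=> x0 i j ij.
pose y : 'M[K]_n := delta_mx j i - ((i == j)%:R / n%:R)%:M.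
have yg : y \in seaweed K n a b.
  apply/mem_seaweed_parabolic; split=> [|s t ks tk].
    rewrite linearB /= mxtrace_scalar -[X in _ - X]mulr_natr divfK ?n_neq0 //.
    rewrite /mxtrace (bigD1 j) //= mxE eqxx big1 ?addr0 => [|l lj].
      by rewrite /= eq_sym subrr.
    by rewrite mxE (negPf lj).
  rewrite !mxE; have -> : (s == t) = false by apply/eqP=> st; move: ks; rewrite st leqNgt tk.
  rewrite mulr0n subr0; case: eqP => //= sj; case: eqP => //= ti.
  by move: ij; rewrite -sj -ti ks tk.
have := x0 (Subvs yg); rewrite meander_formE /= commutator_trace.
rewrite mulmxBr linearB /= mul_mx_scalar linearZ /=.
have -> : \tr (commutator meander_mx (vsval x)) = 0.
  by rewrite linearB /= mxtrace_mulC subrr.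
rewrite mulr0 subr0 => tr0.
rewrite -{}tr0 /mxtrace (bigD1 i) //= [X in _ + X]big1 ?addr0 => [|l li].
  rewrite [RHS]mxE (bigD1 j) //= [delta_mx _ _ _ _]mxE !eqxx mulr1 big1 ?addr0 // => l lj.
  by rewrite [delta_mx _ _ _ _]mxE (negPf lj) mulr0.
by rewrite mxE; apply: big1 => r _; rewrite [delta_mx _ _ _ _]mxE (negPf li) andbF mulr0.
Qed.

Let vtx (t : nat) : 'I_n := insubd (Ordinal (ltn_addl k (isT : 0 < 2)%N)) (vertex m t).

Let vtx_val t : (t <= 2 * m)%N -> vtx t = vertex m t :> nat.
Proof. by move=> tm; rewrite insubdK // unfold_in; have := vertex_lt m_gt1 tm; lia. Qed.

Let vtx_position (u : 'I_n) : vtx (position m u) = u.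
Proof.
have um : (u <= 2 * m)%N by have := ltn_ord u; lia.
by apply: val_inj; rewrite /= vtx_val ?positionK // position_lt.
Qed.

Let sum_vtx (F : 'I_n -> K) : \sum_u F u = \sum_(t < (2 * m).+1) F (vtx t).
Proof.
have posm (u : 'I_n) : (position m u < (2 * m).+1)%N.
  by apply: position_lt => //; have := ltn_ord u; lia.
rewrite (reindex (fun t : 'I_(2 * m).+1 => vtx t)) //.
exists (fun u => Ordinal (posm u)) => [t _ | u _ /=]; last exact: vtx_position.
have tm : (t <= 2 * m)%N by have := ltn_ord t.
by apply: val_inj; rewrite /= vtx_val // vertexK.
Qed.

Let arc_vtx s t : (s <= 2 * m)%N -> (t <= 2 * m)%N ->
  Defs.arc a b (vtx s) (vtx t) = pos_arc m s t.
Proof. by move=> sm tm; rewrite (arc_position m_gt1 k_def) !vtx_val // !vertexK. Qed.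

Let mulf_vtx (x : 'M[K]_n) s t : (s <= 2 * m)%N -> (t <= 2 * m)%N ->
  (meander_mx *m x) (vtx s) (vtx t) = shift_row m (fun s t => x (vtx s) (vtx t)) s t.
Proof.
move=> sm tm; rewrite mxE sum_vtx /shift_row.
(* Arcs into position s can only start at s - 1 or s + 1. At s = 0 the truncated [s.-1] is harmless,
   since the guard 0 < s gives 0. *)
have E (r : 'I_(2 * m).+1) : meander_mx (vtx s) (vtx r) * x (vtx r) (vtx t) =
    (if r == s.-1 :> nat then if (0 < s <= m.+1)%N then x (vtx s.-1) (vtx t) else 0 else 0) +
    (if r == s.+1 :> nat then if (m < s < 2 * m)%N then x (vtx s.+1) (vtx t) else 0 else 0).
  have rm : (r <= 2 * m)%N by have := ltn_ord r.
  rewrite mxE arc_vtx // /pos_arc.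
  case: (eqVneq (r : nat) s.-1) => [rE|rs].
    rewrite rE.
    case: (eqVneq s.-1 s.+1) => [|_]; first by lia.
    rewrite addr0; case: ifP => sI;
      [rewrite (_ : _ || _ = true) ?mul1r | rewrite (_ : _ || _ = false) ?mul0r] => //; lia.
  rewrite add0r; case: (eqVneq (r : nat) s.+1) => [rE|rs'].
    rewrite rE; case: ifP => sI;
      [rewrite (_ : _ || _ = true) ?mul1r | rewrite (_ : _ || _ = false) ?mul0r] => //; lia.
  by rewrite (_ : _ || _ = false) ?mul0r //; lia.
under eq_bigr => r _ do rewrite E.
rewrite big_split /= !sum_ord_at.
by congr (_ + _); do ![case: ifP => //]; lia.
Qed.

Let mulxf_vtx (x : 'M[K]_n) s t : (s <= 2 * m)%N -> (t <= 2 * m)%N ->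
  (x *m meander_mx) (vtx s) (vtx t) = shift_col m (fun s t => x (vtx s) (vtx t)) s t.
Proof.
move=> sm tm; rewrite mxE sum_vtx /shift_col.
have E (r : 'I_(2 * m).+1) : x (vtx s) (vtx r) * meander_mx (vtx r) (vtx t) =
    (if r == t.+1 :> nat then if (t <= m)%N then x (vtx s) (vtx t.+1) else 0 else 0) +
    (if r == t.-1 :> nat then if (m.+1 < t)%N then x (vtx s) (vtx t.-1) else 0 else 0).
  have rm : (r <= 2 * m)%N by have := ltn_ord r.
  rewrite mxE arc_vtx // /pos_arc.
  case: (eqVneq (r : nat) t.+1) => [rE|rs].
    rewrite rE.
    case: (eqVneq t.+1 t.-1) => [|_]; first by lia.
    rewrite addr0; case: ifP => sI;
      [rewrite (_ : _ || _ = true) ?mulr1 | rewrite (_ : _ || _ = false) ?mulr0] => //; lia.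
  rewrite add0r; case: (eqVneq (r : nat) t.-1) => [rE|rs'].
    rewrite rE; case: ifP => sI;
      [rewrite (_ : _ || _ = true) ?mulr1 | rewrite (_ : _ || _ = false) ?mulr0] => //; lia.
  by rewrite (_ : _ || _ = false) ?mulr0 //; lia.
under eq_bigr => r _ do rewrite E.
rewrite big_split /= !sum_ord_at.
by congr (_ + _); do ![case: ifP => //]; lia.
Qed.

(** Read in path positions, an element of the radical satisfies the equations of
    [centralizer_scalar], so it is scalar; its trace is 0 and 2 m + 1 is invertible, so it is 0. *)
Lemma meander_form_frobenius : frobenius_form meander_form.
Proof.
move=> x /commutator_meander0 x0; apply: val_inj => /=.
have [trx xlow] := (mem_seaweed_parabolic _).1 (valP x).
pose Y s t := vsval x (vtx s) (vtx t).
have k_le t : (t <= 2 * m)%N -> (k <= vtx t)%N = (t == m) || (t == m.+1).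
  by move=> tm; rewrite vtx_val // k_def vertex_low // addn1.
have Yscalar : forall s t, (s <= 2 * m)%N -> (t <= 2 * m)%N ->
    Y s t = Y 0%N 0%N *+ (s == t).
  apply: (centralizer_scalar m_gt1) => s t sm tm.
    rewrite -!k_le // -ltnNge; exact: xlow.
  rewrite -!k_le // -mulf_vtx // -mulxf_vtx // => st.
  apply/eqP; rewrite -subr_eq0; apply/eqP.
  by have := x0 (vtx s) (vtx t); rewrite !mxE; apply; rewrite negb_and orbC -leqNgt.
have Y0 : Y 0%N 0%N = 0.
  have : \tr (vsval x) = Y 0%N 0%N *+ (2 * m).+1.
    rewrite /mxtrace sum_vtx (eq_bigr (fun=> Y 0%N 0%N)) => [|t _].
      by rewrite sumr_const card_ord.
    by have := Yscalar t t; rewrite eqxx; apply; have := ltn_ord t.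
  rewrite trx => /esym/eqP; rewrite -mulr_natr mulf_eq0 (negPf (char0 _)) orbF.
  by move/eqP.
apply/matrixP=> i j; rewrite mxE -(vtx_position i) -(vtx_position j).
rewrite -[LHS]/(Y _ _) Yscalar ?Y0 ?mul0rn // position_lt //.
  by have := ltn_ord i; lia.
by have := ltn_ord j; lia.
Qed.
End MeanderForm.

(** * Spectra *)

(** The Gram matrix of F is invertible by nondegeneracy, and the coordinates of h solve a linear
    system with this matrix. *)
Lemma principal_exists (K : fieldType) (L : lieAlgType K) (F : 'Hom(L, K^o)) :
  frobenius_form F -> exists h, principal F h.
Proof.
move=> frobF; pose b := vbasis {:L}; have bB : basis_of {:L} b by exact: vbasisP.
pose M : 'M[K]_(\dim {:L}) := \matrix_(i, j) F (lie b`_i b`_j).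
have lieDl a u v w : lie (a *: u + v) w = a *: lie u w + lie v w :> L.
  exact: lie_linearl.
have lie_suml w (c : 'rV[K]_(\dim {:L})) :
    lie (passmx.vecof b c) w = \sum_i c 0 i *: lie b`_i w.
  have lie0l : lie 0 w = 0 :> L by have := lieDl (-1) 0 0 w; rewrite scaler0 addr0 scaleN1r addNr.
  rewrite /passmx.vecof; apply: (big_rec2 (fun x y => lie x w = y)) => [|i y1 y2 _ <-].
    exact: lie0l.
  exact: lieDl.
have uM u j : (u *m M) 0 j = F (lie (passmx.vecof b u) b`_j).
  rewrite lie_suml linear_sum mxE; apply: eq_bigr => i _.
  by rewrite linearZ mxE.
have M_unit : M \in unitmx.
  rewrite -row_free_unit -kermx_eq0; apply/eqP/row_matrixP=> i; rewrite row0.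
  apply/eqP; rewrite -(passmx.vecof_eq0 bB); apply/eqP/frobF => y.
  rewrite (coord_vbasis (memvf y)) !linear_sum big1 // => j _.
  by rewrite !linearZ /= -uM -row_mul mulmx_ker row0 mxE; exact: mulr0.
pose u := (\row_j F b`_j) *m invmx M; exists (passmx.vecof b u) => x.
rewrite (coord_vbasis (memvf x)) !linear_sum; apply: eq_bigr => j _.
by rewrite !linearZ /= -uM mulmxKV // mxE.
Qed.

(** * The principal element of the meander form and its eigenbasis *)

Section Spectrum.
Variables (K : closedFieldType) (m k : nat).
Hypotheses (m_gt1 : (1 < m)%N) (k_def : k = (2 * m - 1)%N).
Hypothesis char0 : forall n, n.+1%:R != 0 :> K.
Local Notation n := (k + 2)%N.
Local Notation a := [:: k; 2%N].
Local Notation b := [:: (k + 2)%N].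
Local Notation g := (seaweedLie K n a b).

(** The constant that makes [principal_mx] traceless. *)
Definition mean_height : K := (\sum_(u < n) (height m u)%:R) / n%:R.

Definition principal_mx : 'M[K]_n := diag_mx (\row_u (mean_height - (height m u)%:R)).

Lemma principal_mx_seaweed : principal_mx \in seaweed K n a b.
Proof.
apply/mem_seaweed_parabolic; split=> [|i j ki jk].
  rewrite mxtrace_diag (eq_bigr (fun u : 'I_n => mean_height - (height m u)%:R));
    last by move=> u _; rewrite mxE.
  by rewrite sumrB sumr_const card_ord -mulr_natr divfK ?subrr // n_neq0.
rewrite !mxE; have -> : (i == j) = false by apply/eqP=> ij; move: ki; rewrite ij leqNgt jk.
by rewrite mulr0n.
Qed.

Definition principal_elt : g := Subvs principal_mx_seaweed.

Lemma commutator_principal (x : 'M[K]_n) u v :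
  commutator principal_mx x u v = ((height m v)%:Z - (height m u)%:Z)%:~R * x u v.
Proof.
rewrite /commutator mul_diag_mx mul_mx_diag !mxE rmorphB /= [x u v * _]mulrC -mulrBl.
by congr (_ * _); rewrite opprB addrC addrA subrK.
Qed.

(** The form only sees entries on arcs, along which the height rises by 1, so the eigenvalue there
    is 1. *)
Lemma principal_meander : principal (meander_form K k) principal_elt.
Proof.
move=> x; rewrite !meander_formE; apply: eq_bigr => v _; rewrite !mxE.
apply: eq_bigr => u _; rewrite commutator_principal mxE.
case uv: (Defs.arc a b u v); last by rewrite !mul0r.
by rewrite (arc_height m_gt1 k_def uv) -addn1 PoszD addrC addKr !mul1r.
Qed.

Let o : 'I_n := Ordinal (ltn_addl k (isT : 0 < 2)%N).
Let A : {pred 'I_n * 'I_n} := [pred p : 'I_n * 'I_n | allowed p && (p != (o, o))].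
(** Diagonal units are corrected at (o, o) to have trace 0. The pair (o, o) itself would give 0 and
    is left out of [A]. *)
Let e (p : 'I_n * 'I_n) : 'M[K]_n :=
  delta_mx p.1 p.2 - (p.1 == p.2)%:R *: delta_mx o o.
Let s (p : 'I_n * 'I_n) : int := (height m p.2)%:Z - (height m p.1)%:Z.

Let e_seaweed p : p \in A -> e p \in seaweed K n a b.
Proof.
move=> /andP[pA _]; apply/mem_seaweed_parabolic; split=> [|i j ki jk].
  have tr_delta (i j : 'I_n) : \tr (delta_mx i j : 'M[K]_n) = (i == j)%:R.
    rewrite /mxtrace (bigD1 i) //= mxE eqxx big1 ?addr0 // => l li.
    by rewrite mxE (negPf li).
  by rewrite linearB linearZ /= !tr_delta eqxx mulr1 subrr.
have io : (i == o) = false by apply/eqP => io; move: ki; rewrite io /=; lia.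
rewrite !mxE io mulr0 subr0; case: eqP => //= ip; case: eqP => //= jp.
by move: pA; rewrite /allowed -ip -jp ki jk.
Qed.

Let X : #|A|.-tuple g := [tuple vsproj (seaweed K n a b) (e (enum_val i)) : g | i < #|A|].

Let X_val (i : 'I_#|A|) : vsval X`_i = e (enum_val i).
Proof. by rewrite -tnth_nth tnth_mktuple vsprojK // e_seaweed // enum_valP. Qed.

Let sum_X (c : 'I_#|A| -> K) u v : (u, v) != (o, o) ->
  vsval (\sum_i c i *: X`_i) u v = \sum_i c i * ((u, v) == enum_val i)%:R.
Proof.
move=> uv; rewrite linear_sum summxE; apply: eq_bigr => i _.
rewrite linearZ /= mxE X_val; congr (_ * _); rewrite !mxE.
have -> : (u == o) && (v == o) = false by move: uv; rewrite xpair_eqE => /negPf.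
by rewrite mulr0 subr0; case: (enum_val i) => u' v' /=; rewrite xpair_eqE.
Qed.

Let X_basis : basis_of {:g} X.
Proof.
apply/andP; split.
  rewrite eqEsubv subvf /=; apply/subvP => x _.
  suff -> : x = \sum_(i < #|A|) vsval x (enum_val i).1 (enum_val i).2 *: X`_i.
    by apply: rpred_sum => i _; apply/rpredZ/memv_span/mem_nth; rewrite size_tuple.
  set y := \sum_i _; apply/eqP; rewrite -subr_eq0; apply/eqP.
  have yE u v : (u, v) != (o, o) -> vsval y u v = vsval x u v.
    move=> uv; rewrite sum_X //; have [uvA|uvA] := boolP ((u, v) \in A).
      have [l lE] : exists l : 'I_#|A|, enum_val l = (u, v).
        by exists (enum_rank_in uvA (u, v)); rewrite enum_rankK_in.
      rewrite (bigD1 l) //= -lE eqxx mulr1 big1 ?addr0 ?lE // => i il.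
      by rewrite -lE (inj_eq enum_val_inj) eq_sym (negPf il) mulr0.
    rewrite big1 => [|i _].
      move: uvA; rewrite inE uv andbT /allowed negbK /= => /andP[ku vk].
      by rewrite ((mem_seaweed_parabolic _).1 (subvsP x)).2.
    by case: eqP => [uvi|]; [move: uvA; rewrite uvi enum_valP | rewrite mulr0].
  (* The difference x - y vanishes off (o, o), and trace 0 settles the remaining entry. *)
  have [trD D0] := (mem_seaweed_parabolic _).1 (subvsP (x - y)).
  have dE u v : (u, v) != (o, o) -> vsval (x - y) u v = 0.
    by move=> uv; rewrite linearB /= !mxE yE ?subrr.
  apply: val_inj; apply/matrixP => u v; rewrite [RHS]mxE.
  have [[-> ->]|uv] := eqVneq (u, v) (o, o); last exact: dE.
  rewrite -[RHS]trD /mxtrace (bigD1 o) //= big1 ?addr0 // => l lo.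
  by apply: dE; rewrite xpair_eqE andbb.
(* The entry at the pair [enum_val i], which is not (o, o), isolates the coefficient c i. *)
apply/freeP => c cX0 i.
have /andP[_ ni] := enum_valP i.
have := sum_X c (u := (enum_val i).1) (v := (enum_val i).2).
rewrite -surjective_pairing cX0 mxE => /(_ ni) /esym.
rewrite (bigD1 i) //= eqxx mulr1 big1 ?addr0 // => j ji.
by rewrite (inj_eq enum_val_inj) eq_sym (negPf ji) mulr0.
Qed.

Let X_eigen (i : 'I_#|A|) : lie principal_elt X`_i = (s (enum_val i))%:~R *: X`_i.
Proof.
apply: val_inj; rewrite -[LHS]/(commutator principal_mx (vsval X`_i)).
rewrite -[RHS]/((s (enum_val i))%:~R *: vsval X`_i) X_val; apply/matrixP=> u v.
rewrite commutator_principal [RHS]mxE !mxE /s.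
case: (enum_val i) => p q /=.
(* For p = q the vector is diagonal and the eigenvalue is 0; otherwise it is a single elementary
   matrix. *)
case: (eqVneq p q) => [<-|pq]; last first.
  rewrite mul0r subr0; case: eqP => [->|] /=; last by rewrite !mulr0.
  by case: eqP => [->|] /=; rewrite ?mulr0.
rewrite subrr mul0r mul1r; case: (eqVneq u v) => [<-|uv]; first by rewrite subrr mul0r.
have -> : (u == p) && (v == p) = false by apply: contraNF uv => /andP[/eqP-> /eqP->].
have -> : (u == o) && (v == o) = false by apply: contraNF uv => /andP[/eqP-> /eqP->].
by rewrite subrr mulr0.
Qed.

Lemma eigenvalues_principal_elt :
  eigenvalues (ad principal_elt) = intr_mset K (spectrum_mset m k).
Proof.
rewrite (eigenvalues_eigenbasis X_basis X_eigen).
rewrite (spectrum_mset_allowed m_gt1 k_def (o := o)); last by rewrite /=; lia.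
rewrite intr_mset_seq -[in RHS]map_comp; apply/eq_seq_msetP.
have enumA : perm_eq [seq enum_val i | i <- enum 'I_#|A|] (enum A).
  apply: uniq_perm; rewrite ?(map_inj_uniq enum_val_inj) ?enum_uniq // => p.
  apply/mapP/idP => [[i _ ->]|]; first by rewrite mem_enum enum_valP.
  rewrite mem_enum => pA; exists (enum_rank_in pA p); rewrite ?mem_enum //.
  by rewrite enum_rankK_in.
by have := perm_map (fun p => (s p)%:~R : K) enumA; rewrite -map_comp.
Qed.

Lemma meander_has_spectrum :
  has_spectrum (g : lieAlgType K) (intr_mset K (spectrum_mset m k)).
Proof.
have frobM := meander_form_frobenius m_gt1 k_def char0.
split=> [|F frobF]; first by exists (meander_form K k).
have [h prh] := principal_exists frobF; exists h => //.
rewrite -eigenvalues_principal_elt.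
exact: eigenvalues_principal char0 _ _ _ _ frobF frobM prh principal_meander.
Qed.
End Spectrum.

Lemma meander_has_extended_spectrum m k : (1 < m)%N -> k = (2 * m - 1)%N ->
  has_extended_spectrum (k + 2)%N [:: k; 2%N] [:: (k + 2)%N] (extended_mset m k).
Proof.
move=> m_gt1 k_def; apply: (has_extended_spectrum_height m_gt1 k_def).
by apply/msetP => z; rewrite extended_msetE // msetB1E mset_seqE count_allpairs_sum.
Qed.

Unset Implicit Arguments.

Theorem mainTheorem2 (R : realType) (m k : nat)
    (hk : k = (2 * m - 1)%N) (hk1 : (1 < k)%N) :
  let C : closedFieldType := R[i] in
  let n := (k + 2)%N in
  let a := [:: k; 2%N] in
  let b := [:: (k + 2)%N] in
  let gk : lieAlgType C := @seaweedLie C n a b in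
  frobenius gk /\
  (m = 2%N ->
    has_spectrum gk
      (@msetn C 1 (- 2%:R) `+` @msetn C 3 (- 1) `+` @msetn C 5 0
       `+` @msetn C 5 1 `+` @msetn C 3 2%:R `+` @msetn C 1 3%:R)%mset /\
    @has_extended_spectrum n a b
      (@msetn int 1 (- 3%:R) `+` @msetn int 3 (- 2%:R) `+` @msetn int 5 (- 1)
       `+` @msetn int 6 0 `+` @msetn int 5 1 `+` @msetn int 3 2%:R
       `+` @msetn int 1 3%:R)%mset) /\
  ((2 < m)%N ->
    has_spectrum gk
      ((@msetn C 1 (- m%:R) `+` @msetn C 3 (- m%:R + 1)
        `+` @msetn C (2 * k - 1) 0 `+` @msetn C (2 * k - 1) 1
        `+` @msetn C 3 m%:R `+` @msetn C 1 (m%:R + 1))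
       `+` \big[msetD/mset0]_(2 <= i < m)
             (@msetn C (4 * i - 2) (- m%:R + i%:R)
              `+` @msetn C (4 * i - 2) (m%:R - i%:R + 1)))%mset /\
    @has_extended_spectrum n a b
      ((@msetn int 1 (- m%:R - 1) `+` @msetn int 3 (- m%:R)
        `+` @msetn int (2 * k - 1) (- 1) `+` @msetn int (2 * k) 0
        `+` @msetn int (2 * k - 1) 1
        `+` @msetn int 3 m%:R `+` @msetn int 1 (m%:R + 1))
       `+` \big[msetD/mset0]_(1 <= i < m.-1)
             (@msetn int (4 * i + 2) (- m%:R + i%:R)
              `+` @msetn int (4 * i + 2) (m%:R - i%:R)))%mset).
Proof.
move=> C n a b gk.
have m_gt1 : (1 < m)%N by lia.
have char0 j : j.+1%:R != 0 :> C.
  by rewrite -[_ == _]/(j.+1%:R == 0 :> R[i]) pnatr_eq0.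
have spec := meander_has_spectrum m_gt1 hk char0.
have ext := meander_has_extended_spectrum m_gt1 hk.
rewrite intr_spectrum_mset in spec.
split; first by case: spec.
split=> [m2|_]; last by split.
(* For m = 2 the general multisets are specialized: the indexed unions are empty and the
   multiplicities become numerals. *)
have k5 : (2 * k - 1 = 5)%N by lia.
have k6 : (2 * k = 6)%N by lia.
move: spec ext; rewrite /extended_mset k5 k6 m2 !big_geq // !msetD0 => spec ext.
split.
  have -> : - 1 = - 2%:R + 1 :> C by rewrite -[2%:R]/(1 + 1) opprD addrNK.
  by rewrite [3%:R]mulrSr.
exact: ext.
Qed.
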